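(* The following are equivalent: (a) $\mathbf{P}_{\mathbb R}\neq\mathbf{NP}_{\mathbb R}$; (b) $\mathbf{P}'_{\mathbb R}\neq\mathbf{NP}'_{\mathbb R}$.
   Context: $\mathbf{P}_{\mathbb R}$ and $\mathbf{NP}_{\mathbb R}$ are the classical Blum–Shub–Smale classes of subsets of $\mathbb R^\infty=\bigsqcup_k\mathbb R^k$ decidable in (nondeterministic) polynomial time by BSS machines over $\mathbb R$. A machine is a BSS machine over $\mathbb R$ (real constants, exact arithmetic $+,-,\times,/$, branching on the sign of a state coordinate). For input $x$, $T_M(x)\in\mathbb N\cup\{\infty\}$ is its running time and $M(x)$ its output; output $>0$ means YES, $\le 0$ means NO. A decision problem is a pair $(X,\mu)$ with $X\subseteq\mathbb R^\infty$ and $\mu:\mathbb R^\infty\to[1,\infty]$. For $x\in\mathbb R^n$, $\mathrm{Length}(x)=n$ and $\mathrm{Size}(x)=\mathrm{Length}(x)(1+\log_2\mu(x))$ (infinite if $\mu(x)=\infty$). $\mathbf{P}'_{\mathbb R}$ is the class of problems $(X,\mu)$ for which there are a machine $M$ and a polynomial $p$ with: (a) $T_M(x)<p(\mathrm{Size}(x))$ whenever $x\in X$ and $\mathrm{Size}(x)<\infty$; (b) whenever $T_M(x)<\infty$, $M(x)>0\iff x\in X$. $\mathbf{NP}'_{\mathbb R}$ is the class of problems $(X,\mu)$ for which there are a machine $M$ with input $(x,y)$ and a polynomial $p$ with: (a) whenever $x\in X$ and $\mathrm{Size}(x)<\infty$ there is $y$ with $M(x,y)>0$ and $T_M(x,y)<p(\mathrm{Size}(x))$;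 (b) if $T_M(x,y)<\infty$ and $M(x,y)>0$ then $x\in X$. *)

(* Defs.v *)
From HB Require Import structures.
From mathcomp Require Import all_boot all_order all_algebra.
From mathcomp Require Import all_classical all_reals all_analysis.

Set Implicit Arguments.
Unset Strict Implicit.
Unset Printing Implicit Defensive.

Import Order.TTheory GRing.Theory Num.Theory.
Local Open Scope classical_set_scope.
Local Open Scope ring_scope.

(** Blum-Shub-Smale machines over the reals, in the uniform (flow-graph) model:
    a finite graph of nodes acting on a bi-infinite tape of reals. *)

Definition tape (R : realType) := int -> R.

Variant arith := Add | Sub | Mul | Div.

(** Coordinates are addressed relative to the (fixed) origin of the tape; a
    fixed machine reaches unboundedly many of them by shifting the tape. *)
Variant node (R : realType) (Q : Type) :=
| Const of int & R & Q                  (* x_i := c *)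
| Arith of arith & int & int & int & Q  (* x_i := x_j op x_k *)
| Branch of int & Q & Q                 (* first successor iff 0 <= x_i *)
| ShiftL of Q
| ShiftR of Q
| Output.
Arguments Output {R Q}.

Record machine (R : realType) := Machine {
  label : finType;
  start : label;
  node_at : label -> node R label }.

Section Semantics.
Variable R : realType.

Definition upd (s : tape R) (i : int) (v : R) : tape R :=
  fun j => if j == i then v else s j.

(** [None]: division by zero, the operation is undefined. *)
Definition arith_eval (o : arith) (a b : R) : option R :=
  match o with
  | Add => Some (a + b)
  | Sub => Some (a - b)
  | Mul => Some (a * b)
  | Div => if b == 0 then None else Some (a / b)
  end.

Variable M : machine R.

(** Output nodes are fixed; a machine about to divide by zero is stuck at the
    offending node, hence never halts. *)
Definition step (c : label M * tape R) : label M * tape R :=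
  let: (q, s) := c in
  match node_at q with
  | Const i a q' => (q', upd s i a)
  | Arith o i j k q' =>
      if arith_eval o (s j) (s k) is Some v then (q', upd s i v) else c
  | Branch i q1 q2 => (if 0 <= s i then q1 else q2, s)
  | ShiftL q' => (q', fun i => s (i + 1))
  | ShiftR q' => (q', fun i => s (i - 1))
  | Output => c
  end.

Definition run (s : tape R) (t : nat) : label M * tape R :=
  iter t step (start M, s).

Definition halted (s : tape R) (t : nat) : bool :=
  if node_at (run s t).1 is Output then true else false.

Definition halting_time (s : tape R) : option nat :=
  if pselect (exists t, halted s t) is left h then Some (ex_minn h) else None.

Definition time (s : tape R) : \bar R :=
  if halting_time s is Some t then t%:R%:E else +oo%E.

(** Meaningful only when [time s] is finite. *)
Definition output (s : tape R) : R :=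
  if halting_time s is Some t then (run s t).2 0 else 0.

End Semantics.

(** The input [x] in [R^n] is laid out as [..., 0, 1, ..., 1 . x_1, ..., x_n, 0, ...]
    with [n] ones to the left of the origin, giving the length in unary. *)
Definition input (R : realType) (x : seq R) : tape R :=
  fun i => match i with
  | Posz k => x`_k
  | Negz k => (k < size x)%N%:R
  end.

(** A pair is presented on two interleaved tracks: [input x] on the even
    coordinates and [input y] on the odd ones. *)
Definition input2 (R : realType) (x y : seq R) : tape R :=
  fun i => if (i %% 2)%Z == 0 then input x (i %/ 2)%Z else input y (i %/ 2)%Z.

Section Classes.
Variable R : realType.

(** [R^\infty] is [seq R]. *)

Definition P_R : set (set (seq R)) :=
  [set X | exists (M : machine R) (p : {poly R}), forall x,
     (time M (input x) < (p.[(size x)%:R])%:E)%E /\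
     (0 < output M (input x) <-> X x)].

Definition NP_R : set (set (seq R)) :=
  [set X | exists (M : machine R) (p : {poly R}),
     (forall x, X x -> exists y,
        0 < output M (input2 x y) /\
        (time M (input2 x y) < (p.[(size x)%:R])%:E)%E) /\
     (forall x y, (time M (input2 x y) < +oo)%E ->
        0 < output M (input2 x y) -> X x)].

Record problem := Problem {
  yes : set (seq R);
  cond : seq R -> \bar R;
  cond_ge1 : forall x, (1 <= cond x)%E }.

Definition Size (A : problem) (x : seq R) : \bar R :=
  if cond A x is r%:E then ((size x)%:R * (1 + ln r / ln 2))%:E else +oo%E.

Definition P'_R : set problem :=
  [set A | exists (M : machine R) (p : {poly R}),
     (forall x, yes A x -> (Size A x < +oo)%E ->
        (time M (input x) < (p.[fine (Size A x)])%:E)%E) /\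
     (forall x, (time M (input x) < +oo)%E ->
        (0 < output M (input x) <-> yes A x))].

Definition NP'_R : set problem :=
  [set A | exists (M : machine R) (p : {poly R}),
     (forall x, yes A x -> (Size A x < +oo)%E -> exists y,
        0 < output M (input2 x y) /\
        (time M (input2 x y) < (p.[fine (Size A x)])%:E)%E) /\
     (forall x y, (time M (input2 x y) < +oo)%E ->
        0 < output M (input2 x y) -> yes A x)].

End Classes.

(* Main.v *)
Require Import Defs.
From mathcomp Require Import all_boot all_order all_algebra.
From mathcomp Require Import all_classical all_reals all_analysis.
From mathcomp Require Import zify ring lra.

(** Idea. The inclusions from left to right hold because a machine on one input
    can be run on the even track of a pair.

    P' = NP' implies NP included in P: with condition number 1 the two notions of
    size agree, so a problem in NP gets a semi-decision procedure that is
    polynomial on the accepted inputs; running it against a polynomial clock makes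
    it total.

    P = NP implies NP' included in P': given a verifier M, "M accepts (x, y) for
    some y within T steps" is an NP property of x padded to a length
    proportional to T, hence is decided in polynomial time by some N. Running N
    for T = 2n + 1, 2n + 2, and so on until it accepts takes time polynomial in
    the size, although the size itself is unknown to the machine, and never
    accepts outside of the problem.

    Both simulations run on a tape with a gap of registers next to the head. The
    simulated tape is spread out into blocks, and each of its cells is initialised
    lazily from the input data, with a time stamp, so that starting a new
    simulation does not require any cleaning. *)

Set Implicit Arguments.
Unset Strict Implicit.
Unset Printing Implicit Defensive.

Import Order.TTheory GRing.Theory Num.Theory.
Local Open Scope ring_scope.

(** * Programs and their compilation to machines *)

Section Halting.
Variables (R : realType) (M : machine R).
Implicit Type s : tape R.

(** Nodes address only fixed coordinates relative to the head, and the cells around the origin may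
    all carry input, so working memory has to be created and has to travel with the head. Blocks are
    as wide as the gap, 16 cells, and moving by a block is a fixed program.

    The constants of the padding follow. On a pair tape 16 cells hold 8 entries of each track, so a
    word of length [8 * T] shows [T] groups of marks, one of which is lost when the gap is opened
    over it. The verifier does no spreading: the entries of [x] sit at positions [16 * p] of the
    padded word and the guess has to come spread as well, so that both already lie in the blocks of
    the cells they initialise. When the decider of padded words is simulated in its turn, entries
    are spread by another factor 16, whence 256.

    A witness may be arbitrarily long, so its marks cannot be counted in polynomial time; its length
    is guessed too, as a real number. Real time bounds become clocks [c * (n + 1) ^ d] with natural
    [c] and [d]. *)

Lemma run_add s t u : run M s (t + u) = iter u (@step R M) (run M s t).
Proof. by rewrite /run addnC iterD. Qed.

Lemma halted_fix s t u : halted M s t -> (t <= u)%N -> run M s u = run M s t.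
Proof.
move=> ht /subnKC <-; rewrite run_add; elim: (u - t)%N => // k IH.
rewrite iterS IH; move: ht; rewrite /halted /step.
by case: (run M s t) => q w /=; case: (node_at q).
Qed.

Lemma halted_leq s t u : halted M s t -> (t <= u)%N -> halted M s u.
Proof. by move=> ht tu; rewrite /halted (halted_fix ht tu). Qed.

Lemma halted_time s t : halted M s t -> (time M s <= t%:R%:E)%E.
Proof.
move=> ht; rewrite /time /halting_time; case: pselect => [h|[]]; last by exists t.
by rewrite lee_fin ler_nat; case: ex_minnP => m _; apply.
Qed.

Lemma halted_output s t : halted M s t -> output M s = (run M s t).2 0.
Proof.
move=> ht; rewrite /output /halting_time; case: pselect => [h|[]]; last by exists t.
by case: ex_minnP => m hm /(_ _ ht) mt; rewrite (halted_fix hm mt).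
Qed.

Lemma time_lt_halted s (B : \bar R) :
  (time M s < B)%E -> exists2 t, halted M s t & (t%:R%:E < B)%E.
Proof.
rewrite /time /halting_time; case: pselect => [h|_]; last by rewrite ltNge leey.
by case: ex_minnP => m hm _ mB; exists m.
Qed.

Lemma time_fin s : (time M s < +oo)%E <-> exists t, halted M s t.
Proof.
split=> [/time_lt_halted[t ht _]|[t ht]]; first by exists t.
by apply: (le_lt_trans (halted_time ht)); rewrite ltry.
Qed.

End Halting.

Section Programs.
Variable R : realType.
Implicit Type s : tape R.

Inductive cmd :=
| CSkip
| CConst of int & R
| CArith of arith & int & int & int
| CShL
| CShR
| CSeq of cmd & cmd
| CIf of int & cmd & cmd
| CWhile of int & cmd.

(* Division is only performed when the divisor is negative, so that programs
   never get stuck. *)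
Definition arith_den (o : arith) (i j k : int) s : tape R :=
  match o with
  | Add => upd s i (s j + s k)
  | Defs.Sub => upd s i (s j - s k)
  | Mul => upd s i (s j * s k)
  | Div => if 0 <= s k then s else upd s i (s j / s k)
  end.

(** The time index is exact: it counts the nodes visited in the compiled graph. [CSkip] costs one
    because it becomes a branch with equal successors, and a division costs one more when its guard
    lets it through. *)
Inductive exec : cmd -> tape R -> nat -> tape R -> Prop :=
| ExSkip s : exec CSkip s 1 s
| ExConst i a s : exec (CConst i a) s 1 (upd s i a)
| ExArith o i j k s :
    exec (CArith o i j k) s
      (if o is Div then if 0 <= s k then 1 else 2 else 1) (arith_den o i j k s)
| ExShL s : exec CShL s 1 (fun i => s (i + 1))
| ExShR s : exec CShR s 1 (fun i => s (i - 1))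
| ExSeq c1 c2 s1 s2 s3 t1 t2 : exec c1 s1 t1 s2 -> exec c2 s2 t2 s3 ->
    exec (CSeq c1 c2) s1 (t1 + t2) s3
| ExIf i c1 c2 s s' t : exec (if 0 <= s i then c1 else c2) s t s' ->
    exec (CIf i c1 c2) s t.+1 s'
| ExWhileT i c s1 s2 s3 t1 t2 : 0 <= s1 i -> exec c s1 t1 s2 ->
    exec (CWhile i c) s2 t2 s3 -> exec (CWhile i c) s1 (t1 + t2).+1 s3
| ExWhileF i c s : ~~ (0 <= s i) -> exec (CWhile i c) s 1 s.

Fixpoint lab (c : cmd) : finType :=
  match c with
  | CArith _ _ _ _ => bool
  | CSeq c1 c2 => (lab c1 + lab c2)%type
  | CIf _ c1 c2 => option (lab c1 + lab c2)%type
  | CWhile _ c => option (lab c)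
  | _ => unit
  end.

Fixpoint entry (c : cmd) : lab c :=
  match c return lab c with
  | CArith _ _ _ _ => true
  | CSeq c1 c2 => inl (entry c1)
  | CIf _ c1 c2 => None
  | CWhile _ c => None
  | CSkip => tt | CConst _ _ => tt | CShL => tt | CShR => tt
  end.

(** Compilation in place: [emb] injects the labels of the subprogram into the ambient graph and [ex]
    is the label at which it is left. No subgraph has to be glued or relabelled afterwards. *)
Fixpoint nodes (Q : Type) (c : cmd) : (lab c -> Q) -> Q -> lab c -> node R Q :=
  match c return (lab c -> Q) -> Q -> lab c -> node R Q with
  | CSkip => fun _ ex _ => Branch R 0 ex ex
  | CConst i a => fun _ ex _ => Const i a ex
  | CArith o i j k => fun emb ex l =>
      if o is Div then
        if l then Branch R k ex (emb false) else Arith R Div i j k ex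
      else Arith R o i j k ex
  | CShL => fun _ ex _ => ShiftL R ex
  | CShR => fun _ ex _ => ShiftR R ex
  | CSeq c1 c2 => fun emb ex l =>
      match l with
      | inl l1 => nodes (fun l => emb (inl l)) (emb (inr (entry c2))) l1
      | inr l2 => nodes (fun l => emb (inr l)) ex l2
      end
  | CIf i c1 c2 => fun emb ex l =>
      match l with
      | None => Branch R i (emb (Some (inl (entry c1)))) (emb (Some (inr (entry c2))))
      | Some (inl l1) => nodes (fun l => emb (Some (inl l))) ex l1
      | Some (inr l2) => nodes (fun l => emb (Some (inr l))) ex l2
      end
  | CWhile i c => fun emb ex l =>
      match l with
      | None => Branch R i (emb (Some (entry c))) ex
      | Some l => nodes (fun l => emb (Some l)) (emb None) l
      end
  end.

Definition mach (c : cmd) : machine R :=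
  @Machine R (option (lab c)) (Some (entry c))
    (fun l => if l is Some l' then nodes Some None l' else Output).

Definition hosts (M : machine R) (c : cmd) (emb : lab c -> label M) (ex : label M) :=
  forall l, node_at (emb l) = nodes emb ex l.

Lemma exec_iter (M : machine R) c (emb : lab c -> label M) ex s t s' :
  hosts emb ex -> exec c s t s' ->
  iter t (@step R M) (emb (entry c), s) = (ex, s').
Proof.
move=> hc e; elim: e emb ex hc => {c s t s'}.
- by move=> s emb ex hc; rewrite /= (hc tt) /=; case: ifP.
- by move=> i a s emb ex hc; rewrite /= (hc tt).
- move=> o i j k s emb ex hc /=.
  case: o emb hc => emb hc; have /= e1 := hc true; rewrite /= ?e1 //.
  have /= e2 := hc false; case: ifP => sk /=; first by rewrite e1 sk.
  rewrite e1 sk /= e2 /=; case: eqP sk => [->|//]; by rewrite lexx.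
- by move=> s emb ex hc; rewrite /= (hc tt).
- by move=> s emb ex hc; rewrite /= (hc tt).
- move=> c1 c2 s1 s2 s3 t1 t2 _ IH1 _ IH2 emb ex hc.
  rewrite addnC iterD.
  rewrite (IH1 (fun l => emb (inl l)) (emb (inr (entry c2)))) => [|l].
    by apply: (IH2 (fun l => emb (inr l))) => l; rewrite (hc (inr l)).
  by rewrite (hc (inl l)).
- move=> i c1 c2 s s' t _ IH emb ex hc; rewrite iterSr /= (hc None) /=.
  move: IH; case: ifP => _ IH.
    by apply: (IH (fun l => emb (Some (inl l)))) => l; rewrite (hc (Some (inl l))).
  by apply: (IH (fun l => emb (Some (inr l)))) => l; rewrite (hc (Some (inr l))).
- move=> i c s1 s2 s3 t1 t2 si _ IH1 _ IH2 emb ex hc.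
  rewrite iterSr /= (hc None) /= si addnC iterD.
  rewrite (IH1 (fun l => emb (Some l)) (emb None)) => [|l].
    exact: (IH2 emb ex).
  by rewrite (hc (Some l)).
- move=> i c s si emb ex hc; rewrite /= (hc None) /=.
  by rewrite (negbTE si).
Qed.

Lemma exec_mach c s t s' : exec c s t s' -> run (mach c) s t = (None, s').
Proof. by move=> e; apply: (exec_iter (M := mach c) (emb := Some)) e => l. Qed.

Lemma exec_halted c s t s' : exec c s t s' -> halted (mach c) s t.
Proof. by move=> e; rewrite /halted (exec_mach e). Qed.

Lemma exec_output c s t s' : exec c s t s' -> output (mach c) s = s' 0.
Proof. by move=> e; rewrite (halted_output (exec_halted e)) (exec_mach e). Qed.

(** The head of the loop is reached at arbitrarily late times and is not an output node, whereas a
    halted configuration is fixed forever. This is what keeps an unsuccessful search from giving an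
    answer. *)
Lemma while_diverges c0 i c (c2 : cmd) s0 t0 s1 (Inv : tape R -> Prop) :
  exec c0 s0 t0 s1 -> Inv s1 ->
  (forall s, Inv s -> 0 <= s i /\ exists t s', exec c s t s' /\ Inv s') ->
  forall t, ~~ halted (mach (CSeq c0 (CSeq (CWhile i c) c2))) s0 t.
Proof.
set M := mach _; move=> e0 I1 HI t; apply/negP => ht.
have [u tu [s [Is us]]] : exists2 u, (t <= u)%N &
    exists s, Inv s /\ run M s0 u = (Some (inr (inl None)), s).
  elim: t {ht} => [|t [u tu [s [Is us]]]].
    exists t0 => //; exists s1; split=> //.
    exact: (exec_iter (M := M) (c := c0) (emb := fun l => Some (inl l))
       (ex := Some (inr (inl None)))).
  have [si [v [s' [ev Is']]]] := HI _ Is.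
  exists (u + v.+1)%N; first by rewrite addnS ltnS (leq_trans tu) ?leq_addr.
  exists s'; split=> //; rewrite run_add us iterSr /= si.
  exact: (exec_iter (M := M) (c := c) (emb := fun l => Some (inr (inl (Some l))))
       (ex := Some (inr (inl None))) _ ev).
by have := halted_leq ht tu; rewrite /halted us.
Qed.

Definition execb c s (T : nat) s' := exists2 t, (t <= T)%N & exec c s t s'.

Lemma execb_le c s T T' s' : (T <= T')%N -> execb c s T s' -> execb c s T' s'.
Proof. by move=> TT' [t tT e]; exists t => //; apply: leq_trans tT TT'. Qed.

Lemma execb_seq c1 c2 s1 s2 s3 T1 T2 : execb c1 s1 T1 s2 -> execb c2 s2 T2 s3 ->
  execb (CSeq c1 c2) s1 (T1 + T2) s3.
Proof.
by move=> [t1 l1 e1] [t2 l2 e2]; exists (t1 + t2)%N; [exact: leq_add|exact: ExSeq e2].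
Qed.

Lemma execb_if i c1 c2 s s' T : execb (if 0 <= s i then c1 else c2) s T s' ->
  execb (CIf i c1 c2) s T.+1 s'.
Proof. by move=> [t l e]; exists t.+1 => //; apply: ExIf. Qed.

Lemma execb_while i c s1 s2 s3 T1 T2 : 0 <= s1 i -> execb c s1 T1 s2 ->
  execb (CWhile i c) s2 T2 s3 -> execb (CWhile i c) s1 (T1 + T2).+1 s3.
Proof.
move=> si [t1 l1 e1] [t2 l2 e2]; exists (t1 + t2).+1; last exact: ExWhileT e2.
by rewrite ltnS leq_add.
Qed.

Lemma execb_while_end i c s : ~~ (0 <= s i) -> execb (CWhile i c) s 1 s.
Proof. by exists 1%N => //; apply: ExWhileF. Qed.

Fixpoint loopfree (c : cmd) : bool :=
  match c with
  | CSeq c1 c2 | CIf _ c1 c2 => loopfree c1 && loopfree c2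
  | CWhile _ _ => false
  | _ => true
  end.

Fixpoint den (c : cmd) s : tape R :=
  match c with
  | CSkip => s
  | CConst i a => upd s i a
  | CArith o i j k => arith_den o i j k s
  | CShL => fun i => s (i + 1)
  | CShR => fun i => s (i - 1)
  | CSeq c1 c2 => den c2 (den c1 s)
  | CIf i c1 c2 => if 0 <= s i then den c1 s else den c2 s
  | CWhile i c => s
  end.

Fixpoint cost (c : cmd) : nat :=
  match c with
  | CArith _ _ _ _ => 2
  | CSeq c1 c2 => cost c1 + cost c2
  | CIf _ c1 c2 => (cost c1 + cost c2).+1
  | _ => 1
  end.

Lemma den_exec c s : loopfree c -> execb c s (cost c) (den c s).
Proof.
elim: c s => //=.
- by exists 1%N => //; constructor.
- by move=> i a s _; exists 1%N => //; constructor.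
- move=> o i j k s _; eexists; last exact: ExArith.
  by case: o => //; case: ifP.
- by exists 1%N => //; constructor.
- by exists 1%N => //; constructor.
- by move=> c1 IH1 c2 IH2 s /andP[l1 l2]; apply: execb_seq; [exact: IH1|exact: IH2].
- move=> i c1 IH1 c2 IH2 s /andP[l1 l2]; apply: execb_if.
  case: ifP => _; [apply: execb_le (IH1 s l1)|apply: execb_le (IH2 s l2)];
  [exact: leq_addr|exact: leq_addl].
Qed.

End Programs.
Arguments CSkip {R}.
Arguments CArith {R}.
Arguments CShL {R}.
Arguments CShR {R}.

(** * The inclusions of P in NP and of P' in NP' *)

Section Stretch.
Variables (R : realType) (M : machine R).

(* Every step of [M] takes exactly two steps, so that [M] halts if and only if
   the machine on the even track does. *)
Definition stretch_node (l : label M * bool) : node R (label M * bool)%type :=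
  let: (q, b) := l in
  match node_at q with
  | Const i a q' => if b then Branch R 0 (q', false) (q', false)
                    else Const (2 * i) a (q, true)
  | Arith o i j k q' => if b then Branch R 0 (q', false) (q', false)
                        else Arith R o (2 * i) (2 * j) (2 * k) (q, true)
  | Branch i q1 q2 => if b then Branch R (2 * i) (q1, false) (q2, false)
                      else Branch R 0 (q, true) (q, true)
  | ShiftL q' => if b then ShiftL R (q', false) else ShiftL R (q, true)
  | ShiftR q' => if b then ShiftR R (q', false) else ShiftR R (q, true)
  | Output => Output
  end.

Definition stretch : machine R :=
  @Machine R (label M * bool)%type (start M, false) stretch_node.

Definition on_even (s s' : tape R) := forall i, s' (2 * i) = s i.

Lemma on_even_upd s s' i v : on_even s s' -> on_even (upd s i v) (upd s' (2 * i) v).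
Proof.
move=> h j; rewrite /upd h; congr (if _ then _ else _).
by apply/eqP/eqP; lia.
Qed.

Lemma stretch_step q s s' : on_even s s' -> exists s'',
  on_even (step (q, s)).2 s'' /\
  iter 2 (@step R stretch) ((q, false), s') = (((step (q, s)).1, false), s'').
Proof.
move=> h; rewrite /step [iter _ _ _]/= /=.
case E: (node_at q) => [i a q'|o i j k q'|i q1 q2|q'|q'|] /=; rewrite ?E /=.
- by rewrite if_same; eexists; split; last reflexivity; exact: on_even_upd.
- rewrite !h; case E2: (arith_eval o (s j) (s k)) => [v|] /=; rewrite ?E /=.
    by rewrite if_same; eexists; split; last reflexivity; exact: on_even_upd.
  by rewrite !h E2 /=; exists s'.
- rewrite if_same /= E /= h; exists s'; split=> //.
  by case: ifP.
- eexists; split; last reflexivity.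
  by move=> i /=; rewrite -h; congr s'; lia.
- eexists; split; last reflexivity.
  by move=> i /=; rewrite -h; congr s'; lia.
- by exists s'.
Qed.

Lemma stretch_run s s' t : on_even s s' -> exists s'',
  on_even (run M s t).2 s'' /\ run stretch s' (t + t) = (((run M s t).1, false), s'').
Proof.
move=> h; elim: t => [|t [s1 [h1 e1]]]; first by exists s'.
have -> : (t.+1 + t.+1 = (t + t) + 2)%N by lia.
rewrite run_add e1 /run iterS -/(run M s t).
by case: (run M s t) h1 => q w /= /(stretch_step q)[s2 [h2 e2]]; exists s2.
Qed.

Lemma stretch_halted2 s s' t : on_even s s' ->
  halted stretch s' (t + t) = halted M s t.
Proof.
move=> h; have [s2 [_ e]] := stretch_run t h.
rewrite /halted e /=; by case: (node_at _).
Qed.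

(** The two machines are comparable only at even times; a halting time [t] may be replaced by
    [t + t], since halting persists. *)
Lemma stretch_halts s s' : on_even s s' ->
  (time stretch s' < +oo)%E -> (time M s < +oo)%E.
Proof.
move=> h /time_fin[t ht]; apply/time_fin; exists t.
by rewrite -(stretch_halted2 t h); apply: halted_leq ht _; exact: leq_addr.
Qed.

Lemma stretch_output s s' : on_even s s' -> (time M s < +oo)%E ->
  output stretch s' = output M s.
Proof.
move=> h /time_fin[t ht]; have ht' : halted stretch s' (t + t).
  by rewrite (stretch_halted2 t h).
rewrite (halted_output ht) (halted_output ht').
by have [s2 [h2 ->]] := stretch_run t h; rewrite -h2 mulr0.
Qed.

Lemma stretch_time s s' (r : R) : on_even s s' -> (time M s < r%:E)%E ->
  (time stretch s' < (2 * r)%:E)%E.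
Proof.
move=> h /time_lt_halted[t ht tr].
have ht' : halted stretch s' (t + t) by rewrite (stretch_halted2 t h).
apply: (le_lt_trans (halted_time ht')); move: tr; rewrite !lte_fin natrD.
by move=> tr; lra.
Qed.

Lemma on_even_input2 (x y : seq R) : on_even (input x) (input2 x y).
Proof.
move=> i; rewrite /input2 mulrC.
have -> : ((i * 2) %% 2)%Z = 0 by rewrite modzMl.
by rewrite eqxx mulzK.
Qed.

End Stretch.

Section EasyInclusions.
Variable R : realType.

Lemma P_sub_NP (X : set (seq R)) : P_R X -> NP_R X.
Proof.
move=> [M [p Mp]]; exists (stretch M), (2%:P * p); split.
  move=> x Xx; exists [::].
  have [tx /iffRL/(_ Xx) ox] := Mp x.
  have fin : (time M (input x) < +oo)%E by apply: lt_trans tx (ltry _).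
  rewrite (stretch_output (on_even_input2 _ _)) //; split=> //.
  by rewrite hornerM hornerC; apply: stretch_time tx; exact: on_even_input2.
move=> x y _; have [tx ox] := Mp x.
have fin : (time M (input x) < +oo)%E by apply: lt_trans tx (ltry _).
by rewrite (stretch_output (on_even_input2 _ _)) // => /ox.
Qed.

Lemma P'_sub_NP' (A : problem R) : P'_R A -> NP'_R A.
Proof.
move=> [M [p [Mp Mc]]]; exists (stretch M), (2%:P * p); split.
  move=> x Xx Sx; exists [::].
  have tx := Mp x Xx Sx.
  have fin : (time M (input x) < +oo)%E by apply: lt_trans tx (ltry _).
  rewrite (stretch_output (on_even_input2 _ _)) //.
  rewrite (Mc x fin); split=> //.
  by rewrite hornerM hornerC; apply: stretch_time tx; exact: on_even_input2.
move=> x y /(stretch_halts (on_even_input2 _ _)) fin.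
by rewrite (stretch_output (on_even_input2 _ _)) // => /(Mc x fin).
Qed.

End EasyInclusions.

(** * Registers kept in a gap of the tape *)

Section Registers.
Variable R : realType.
Implicit Types (s h : tape R) (rho : nat -> R) (P : int).

(* A data tape [h] with head at [P] is stored with a gap of 16 cells just left
   of the head: 15 registers and a scratch cell. *)
Definition phys P rho h : tape R := fun i =>
  match i with
  | Posz k => h (P + k)
  | Negz j => if (j < 15)%N then rho j else
              if j == 15%N then 0 else h (P + Negz (j - 16))
  end.

Arguments phys : simpl never.

Definition upr rho (r : nat) (v : R) : nat -> R :=
  fun j => if j == r then v else rho j.

(** Data to the left of the head lie beyond the gap, so only negative offsets are displaced, by
    16. *)
Definition off (c : int) : int :=
  match c with Posz k => Posz k | Negz j => Negz (j + 16) end.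

Lemma phys_reg P rho h r : (r < 15)%N -> phys P rho h (Negz r) = rho r.
Proof. by rewrite /phys => ->. Qed.

Lemma phys_off P rho h c : phys P rho h (off c) = h (P + c).
Proof.
case: c => // j; rewrite /phys /=.
have -> : (j + 16 < 15)%N = false by lia.
have -> : (j + 16 == 15)%N = false by apply/eqP; lia.
by rewrite addnK.
Qed.

Lemma upd_reg P rho h r v : (r < 15)%N ->
  upd (phys P rho h) (Negz r) v = phys P (upr rho r v) h.
Proof.
move=> hr; apply/funext => -[k|j]; rewrite /upd /phys //=.
rewrite /upr -[Negz j == Negz r]/(j == r).
by case: eqP => [->|_]; rewrite ?hr.
Qed.

Lemma off_inj c c' : (off c == off c') = (c == c').
Proof. by case: c c' => [c|c] [c'|c'] //=; apply/eqP/eqP => -[]; lia. Qed.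

Lemma upd_off P rho h c v :
  upd (phys P rho h) (off c) v = phys P rho (upd h (P + c) v).
Proof.
apply/funext => i; rewrite /upd.
have [k|[j [jl ->]]] : (exists c', i = off c') \/ exists j, (j < 16)%N /\ i = Negz j.
- case: i => [k|j]; first by left; exists k.
  case: (ltnP j 16) => hj; first by right; exists j.
  by left; exists (Negz (j - 16)); rewrite /= subnK.
- case: k => c' ->; rewrite off_inj !phys_off.
  by rewrite (inj_eq (addrI P)).
- case: eqP => [|_]; last first.
    by move: jl; rewrite /phys ltnS leq_eqVlt orbC; case: (j < 15)%N => //= ->.
  by case: c => //= c0 [] E; move: jl; rewrite E; lia.
Qed.

Definition setc (r : nat) (v : R) : cmd R := CConst (Negz r) v.
Definition op (o : arith) (r a b : nat) : cmd R :=
  CArith o (Negz r) (Negz a) (Negz b).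
(** There is no copy node; a transfer is an addition to a cleared target. *)
Definition load (r : nat) (c : int) : cmd R :=
  CSeq (CConst (Negz r) 0) (CArith Add (Negz r) (off c) (Negz r)).
Definition store (c : int) (r : nat) : cmd R :=
  CSeq (CConst (off c) 0) (CArith Add (off c) (off c) (Negz r)).
(* The constant [v] passes through the scratch cell. *)
Definition opc (o : arith) (r a : nat) (v : R) : cmd R :=
  CSeq (CConst (Negz 15) v)
    (CSeq (CArith o (Negz r) (Negz a) (Negz 15)) (CConst (Negz 15) 0)).
Definition ifr (r : nat) (c1 c2 : cmd R) : cmd R := CIf (Negz r) c1 c2.
Definition whiler (r : nat) (c : cmd R) : cmd R := CWhile (Negz r) c.

Lemma den_seq c1 c2 s : den (CSeq c1 c2) s = den c2 (den c1 s).
Proof. by []. Qed.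

Lemma den_setc P rho h r v : (r < 15)%N ->
  den (setc r v) (phys P rho h) = phys P (upr rho r v) h.
Proof. exact: upd_reg. Qed.

Definition arith_rho (o : arith) r a b rho := match o with
  | Add => upr rho r (rho a + rho b)
  | Defs.Sub => upr rho r (rho a - rho b)
  | Mul => upr rho r (rho a * rho b)
  | Div => if 0 <= rho b then rho else upr rho r (rho a / rho b)
  end.

Lemma den_op P rho h o r a b : (r < 15)%N -> (a < 15)%N -> (b < 15)%N ->
  den (op o r a b) (phys P rho h) = phys P (arith_rho o r a b rho) h.
Proof.
move=> lr la lb; case: o => /=; rewrite !phys_reg ?upd_reg //.
by case: ifP => _; rewrite ?upd_reg.
Qed.

Lemma den_load P rho h r c : (r < 15)%N ->
  den (load r c) (phys P rho h) = phys P (upr rho r (h (P + c))) h.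
Proof.
move=> lr /=; rewrite upd_reg // phys_off phys_reg // upd_reg //.
congr phys; apply/funext => j; rewrite /upr eqxx; case: eqP => //.
by rewrite addr0.
Qed.

Lemma den_store P rho h r c : (r < 15)%N ->
  den (store c r) (phys P rho h) = phys P rho (upd h (P + c) (rho r)).
Proof.
move=> lr /=; rewrite upd_off phys_off phys_reg // upd_off.
congr phys; apply/funext => j; rewrite /upd eqxx; case: eqP => //.
by rewrite add0r.
Qed.

Lemma upd_same s i v w : upd (upd s i v) i w = upd s i w.
Proof. by apply/funext => j; rewrite /upd; case: eqP. Qed.

Lemma upd_id s i v : s i = v -> upd s i v = s.
Proof. by move=> <-; apply/funext => j; rewrite /upd; case: eqP => [->|]. Qed.

Lemma updC s i j v w : i != j -> upd (upd s i v) j w = upd (upd s j w) i v.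
Proof.
move=> ij; apply/funext => k; rewrite /upd.
by case: (eqVneq k j) => [->|//]; rewrite eq_sym (negbTE ij).
Qed.

Lemma den_opc P rho h o r a v : (r < 15)%N -> (a < 15)%N -> o <> Div ->
  den (opc o r a v) (phys P rho h) =
  phys P (upr rho r (match o with Add => rho a + v
     | Defs.Sub => rho a - v | _ => rho a * v end)) h.
Proof.
move=> lr la od.
have E w : upd (upd (upd (phys P rho h) (Negz 15) v) (Negz r) w) (Negz 15) 0 =
  phys P (upr rho r w) h.
  rewrite (@updC _ (Negz r)); last by case: eqP lr => // -[->].
  rewrite upd_same; have -> : upd (phys P rho h) (Negz 15) 0 = phys P rho h.
    exact: upd_id.
  exact: upd_reg.
have rv : upd (phys P rho h) (Negz 15) v (Negz a) = rho a.
  by rewrite /upd -[Negz a == Negz 15]/(a == 15%N) (ltn_eqF la) phys_reg.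
have vv : upd (phys P rho h) (Negz 15) v (Negz 15) = v by rewrite /upd eqxx.
by case: o od => // _; rewrite /opc !den_seq /den /arith_den rv vv E.
Qed.

Lemma den_ifr P rho h r c1 c2 : (r < 15)%N ->
  den (ifr r c1 c2) (phys P rho h) =
  if 0 <= rho r then den c1 (phys P rho h) else den c2 (phys P rho h).
Proof. by move=> lr /=; rewrite phys_reg. Qed.

Definition cp (d c : int) : cmd R := CSeq (CConst d 0) (CArith Add d d c).

Lemma den_cp d c s : d != c -> den (cp d c) s = upd s d (s c).
Proof.
move=> dc /=; rewrite upd_same; congr upd.
by rewrite /upd eqxx eq_sym (negbTE dc) add0r.
Qed.

Lemma Negz_neqS n : (Negz n.+1 != Negz n) && (Negz n != Negz n.+1).
Proof. by apply/andP; split; apply/eqP => -[]; lia. Qed.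

(** * Moving the head together with its gap *)

Fixpoint cpup n : cmd R :=
  if n is n'.+1 then CSeq (cpup n') (cp (Negz n') (Negz n'.+1)) else CSkip.
Fixpoint cpdown n : cmd R :=
  if n is n'.+1 then CSeq (cp (Negz n'.+1) (Negz n')) (cpdown n') else CSkip.

Lemma den_cpup n s : den (cpup n) s = fun i =>
  if i is Negz j then if (j < n)%N then s (Negz j.+1) else s i else s i.
Proof.
apply/funext; elim: n => [[k|j]|n IH i] //.
rewrite [cpup _]/= den_seq den_cp; last by case/andP: (Negz_neqS n).
rewrite /upd !IH ltnNge leqnSn /=; case: i => [k|j] //=.
rewrite -[Negz j == Negz n]/(j == n) ltnS.
by case: (ltngtP j n) => // ->.
Qed.

Lemma den_cpdown n s : den (cpdown n) s = fun i =>
  if i is Negz j then if (0 < j <= n)%N then s (Negz j.-1) else s i else s i.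
Proof.
apply/funext; elim: n s => [s [k|[|j]]|n IH s i] //.
rewrite [cpdown _]/= den_seq IH den_cp; last by case/andP: (Negz_neqS n).
rewrite /upd.
case: i => [k|j] //=.
rewrite -[Negz j == Negz n.+1]/(j == n.+1) -[Negz j.-1 == Negz n.+1]/(j.-1 == n.+1).
case: j => [|j] //=; rewrite ltnS !eqSS.
by case: (ltngtP j n) => [jn||->]; rewrite ?eqxx //; case: eqP => //; lia.
Qed.

(** A tape shift alone would carry the gap away from the new head. The data cell that is crossed has
    to jump over the gap and the registers are shifted back by one. In [mvR] it lands on the former
    scratch cell, whose value 0 makes the addition a copy; in [mvL] register 0 has strayed to cell 0
    and is rescued before the data cell is put there. *)
Definition mvR : cmd R :=
  CSeq CShL (CSeq (CArith Add (Negz 16) (Negz 16) (Negz 0))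
    (CSeq (cpup 15) (CConst (Negz 15) 0))).
Definition mvL : cmd R :=
  CSeq CShR (CSeq (cpdown 14) (CSeq (cp (Negz 0) 0)
    (CSeq (cp 0 (Negz 15)) (CConst (Negz 15) 0)))).

Lemma Negz_sub1 j : Negz j - 1 = Negz j.+1 :> int.
Proof. by rewrite !NegzE; lia. Qed.
Lemma Negz_add1 j : Negz j.+1 + 1 = Negz j :> int.
Proof. by rewrite !NegzE; lia. Qed.

Lemma den_mvR P rho h : den mvR (phys P rho h) = phys (P + 1) rho h.
Proof.
rewrite /mvR 3!den_seq den_cpup; apply/funext => -[k|j] /=; rewrite /upd /=.
  by rewrite {2}/phys -addrA [1 + _]addrC.
rewrite -[Negz j == Negz 15]/(j == 15%N) -[Negz j.+1 == Negz 16]/(j == 15%N).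
rewrite -[Negz j == Negz 16]/(j == 16%N).
have -> : (Negz 0 + 1 = 0 :> int) by [].
rewrite [in RHS]/phys; case: (ltngtP j 15) => // [jl|jl].
  by rewrite Negz_add1 phys_reg.
case: eqP => [->|jn].
  rewrite -[Negz 16 + 1]/(Negz 15) /phys /= add0r; congr h.
  by rewrite -addrA.
case: j jl jn => // j jl jn; rewrite Negz_add1 /phys.
case: ltnP => [|_]; first lia.
case: eqP => [|_]; first lia.
congr h; rewrite -addrA; congr (_ + _).
by rewrite !NegzE; lia.
Qed.

Lemma den_mvL P rho h : den mvL (phys P rho h) = phys (P - 1) rho h.
Proof.
rewrite /mvL 4!den_seq !den_cp // den_cpdown; apply/funext => i.
rewrite /= /upd /=.
have E : phys P rho h (Negz 15 - 1) = h (P + Negz 0) by rewrite /phys.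
have E0 : phys P rho h (0 - 1) = rho 0%N by [].
case: i => [k|j].
  rewrite -[k == 0 :> int]/(k == 0%N); case: k => [|k].
    by rewrite eqxx E /phys addr0.
  have -> : (k.+1%:Z - 1 = k) by lia.
  rewrite /phys; have -> : P - 1 + k.+1%:Z = P + k by lia.
  by [].
rewrite -[Negz j == Negz 15]/(j == 15%N) -[Negz j == 0]/false.
rewrite -[Negz j == Negz 0]/(j == 0%N) [in RHS]/phys.
case: (ltngtP j 15) => // [jl|jl].
  case: eqP => [->|j0]; first by rewrite E0.
  have -> : (0 < j <= 14)%N by lia.
  by case: j jl j0 => // j jl _; rewrite /= Negz_sub1 phys_reg.
case: eqP => [|_]; first lia.
case: ifP => [|_]; first lia.
rewrite Negz_sub1 /phys; case: ltnP => [|_]; first lia.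
case: eqP => [|_]; first lia.
congr h; rewrite -addrA; congr (_ + _).
by rewrite !NegzE; lia.
Qed.

Fixpoint mvRn n : cmd R := if n is n'.+1 then CSeq mvR (mvRn n') else CSkip.
Fixpoint mvLn n : cmd R := if n is n'.+1 then CSeq mvL (mvLn n') else CSkip.

Lemma den_mvRn n P rho h : den (mvRn n) (phys P rho h) = phys (P + n%:Z) rho h.
Proof.
elim: n P => [P|n IH P]; first by rewrite addr0.
have -> : P + n.+1%:Z = P + 1 + n%:Z by lia.
by rewrite [mvRn _]/= den_seq den_mvR IH.
Qed.

Lemma den_mvLn n P rho h : den (mvLn n) (phys P rho h) = phys (P - n%:Z) rho h.
Proof.
elim: n P => [P|n IH P]; first by rewrite subr0.
have -> : P - n.+1%:Z = P - 1 - n%:Z by lia.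
by rewrite [mvLn _]/= den_seq den_mvL IH.
Qed.

Lemma loopfree_mvRn n : loopfree (mvRn n).
Proof. by elim: n. Qed.
Lemma loopfree_mvLn n : loopfree (mvLn n).
Proof. by elim: n. Qed.

Lemma exec_den c s s' T : loopfree c -> (cost c <= T)%N -> den c s = s' ->
  execb c s T s'.
Proof. by move=> lc cT <-; apply: execb_le cT _; exact: den_exec. Qed.

End Registers.
Arguments op {R}.
Arguments load {R}.
Arguments store {R}.
Arguments mvR {R}.
Arguments mvL {R}.
Arguments mvRn {R}.
Arguments mvLn {R}.

(** * Clocked simulation of a machine *)

(** Roles of the registers: [rN] and [rL] are the lengths of the two components of a pair, [rM] the
    length of a single simulated input, [rC] the clock, [rQ] the rank of the simulated label, [rP]
    the simulated head position and [rPar] its parity, [rE] the epoch, [rV] the verdict; [rI] and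
    [rT] control the outer loops. *)
Local Notation rN := 0%N.
Local Notation rM := 1%N.
Local Notation rC := 2%N.
Local Notation rQ := 3%N.
Local Notation rP := 4%N.
Local Notation rPar := 5%N.
Local Notation rE := 6%N.
Local Notation rV := 7%N.
Local Notation rL := 8%N.
Local Notation t0 := 9%N.
Local Notation t1 := 10%N.
Local Notation t2 := 11%N.
Local Notation t3 := 12%N.
Local Notation rI := 13%N.
Local Notation rT := 14%N.

Section Keep.
Variable R : realType.

Definition keep (l : seq nat) (rho rho' : nat -> R) :=
  forall r, r \notin l -> rho' r = rho r.

Lemma keep_sub l l' rho rho' : {subset l <= l'} -> keep l rho rho' -> keep l' rho rho'.
Proof. by move=> ll k r hr; apply: k; apply: contra hr; exact: ll. Qed.

Lemma keep_trans l rho1 rho2 rho3 :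
  keep l rho1 rho2 -> keep l rho2 rho3 -> keep l rho1 rho3.
Proof. by move=> k1 k2 r hr; rewrite k2 // k1. Qed.

Lemma keep_upr l r v rho rho' : r \in l -> keep l rho rho' -> keep l rho (upr rho' r v).
Proof. by move=> rl k j jl; rewrite /upr; case: eqP jl => [->|_ /k //]; rewrite rl. Qed.

End Keep.

Section Simulation.
Variable R : realType.
Implicit Types (s h : tape R) (rho : nat -> R) (P : int).

(* Virtual cell [i] of the simulated tape owns the block of 16 data cells
   starting at [16 * i]: columns 0 and 1 hold the initial data, column 6 the
   current value, which is meaningful only if the time stamp in column 4 has
   reached the current epoch [e]. *)
Definition rep (e : R) (ini : int -> R) h : tape R :=
  fun i => if e <= h (16 * i + 4) then h (16 * i + 6) else ini i.

(** The simulation writes only columns 4 and 6 of a block, so the initial data survive it and can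
    serve a later epoch. *)
Definition frame h0 h := forall i : int,
  h (16 * i) = h0 (16 * i) /\ h (16 * i + 1) = h0 (16 * i + 1).

Definition stamps (e : R) h := forall i : int, h (16 * i + 4) <= e.

Variables (N : machine R) (initc : int -> cmd R) (ini : int -> R).
Variables (rn rm rl e : R) (h0 : tape R).

Definition good rho h :=
  [/\ rho rN = rn, rho rM = rm, rho rL = rl & frame h0 h].

(** The parity of the position has a register of its own because no loop-free program computes it
    from [rP]. It tells on which track of a pair a cell lies. *)
Definition at_block P rho h :=
  [/\ good rho h, rho rE = e, rho rP = P%:~R & rho rPar = (P %% 2)%Z%:~R].

Hypothesis initc_free : forall o, loopfree (initc o).
Hypothesis initc_den : forall o P rho h, at_block P rho h ->
  exists rho', den (initc o) (phys (16 * P) rho h) = phys (16 * P) rho' h /\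
    rho' t0 = ini (P + o) /\ keep [:: t0; t1] rho rho'.

Definition get (o : int) (r : nat) : cmd R :=
  CSeq (load t0 (16 * o + 4)) (CSeq (op Defs.Sub t0 t0 rE)
    (CSeq (ifr t0 (load t0 (16 * o + 6)) (initc o)) (opc Add r t0 0))).

Definition put (o : int) (r : nat) : cmd R :=
  CSeq (store (16 * o + 6) r) (store (16 * o + 4) rE).

Lemma at_block_keep l P rho rho' h : at_block P rho h -> keep l rho rho' ->
  [&& rN \notin l, rM \notin l, rL \notin l, rE \notin l, rP \notin l & rPar \notin l] ->
  at_block P rho' h.
Proof.
move=> [[a1 a2 a3 a4] a5 a6 a7] k /and5P[l1 l2 l3 l4 /andP[l5 l6]].
by split; [split|..]; rewrite ?k.
Qed.

Lemma den_get o r P rho h : (r < 15)%N -> at_block P rho h -> exists rho',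
  den (get o r) (phys (16 * P) rho h) = phys (16 * P) rho' h /\
  rho' r = rep e ini h (P + o) /\ keep [:: t0; t1; r] rho rho'.
Proof.
move=> lr A; rewrite /get 3!den_seq den_load // den_op // den_ifr //.
set rho1 := arith_rho _ _ _ _ _.
have k1 : keep [:: t0] rho rho1.
  by apply: keep_upr => //; apply: keep_upr.
have -> : rho1 t0 = h (16 * P + (16 * o + 4)) - e.
  by rewrite /rho1 /= /upr /=; case: A => _ ->.
rewrite subr_ge0 /rep.
have -> : 16 * (P + o) + 4 = 16 * P + (16 * o + 4) by ring.
have -> : 16 * (P + o) + 6 = 16 * P + (16 * o + 6) by ring.
case: ifP => _.
  rewrite den_load // den_opc //; eexists; split; first reflexivity.
  split; first by rewrite /upr eqxx /= addr0.
  apply: keep_upr; first by rewrite !inE eqxx !orbT.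
  apply: keep_upr; first by rewrite !inE.
  by apply: keep_sub k1 => x; rewrite !inE => ->.
have [rho2 [-> [v2 k2]]] := initc_den o (at_block_keep A k1 isT).
rewrite den_opc //; eexists; split; first reflexivity.
split; first by rewrite /upr eqxx addr0 v2.
apply: keep_upr; first by rewrite !inE eqxx !orbT.
apply: keep_trans.
  by apply: keep_sub k1 => x; rewrite !inE => ->.
by apply: keep_sub k2 => x; rewrite !inE => /orP[] ->; rewrite ?orbT.
Qed.

Lemma den_put o r P rho h : (r < 15)%N -> rho rE = e -> exists h',
  den (put o r) (phys (16 * P) rho h) = phys (16 * P) rho h' /\
  rep e ini h' = upd (rep e ini h) (P + o) (rho r) /\
  (frame h0 h -> frame h0 h') /\ (stamps e h -> stamps e h').
Proof.
move=> lr Ee; rewrite /put den_seq !den_store //; eexists; split; first reflexivity.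
split; last split.
- apply/funext => i; rewrite /rep /upd Ee.
  have -> : (16 * i + 4 == 16 * P + (16 * o + 4)) = (i == P + o) by apply/eqP/eqP; lia.
  have -> : (16 * i + 4 == 16 * P + (16 * o + 6)) = false by apply/eqP; lia.
  have -> : (16 * i + 6 == 16 * P + (16 * o + 4)) = false by apply/eqP; lia.
  have -> : (16 * i + 6 == 16 * P + (16 * o + 6)) = (i == P + o) by apply/eqP/eqP; lia.
  by case: eqP; rewrite ?lexx.
- move=> F i; have [F1 F2] := F i; split; rewrite /upd.
    by do 2![case: eqP => [|_]; first lia].
  by do 2![case: eqP => [|_]; first lia].
- move=> S i; rewrite /upd Ee; case: eqP => // _.
  by case: eqP => [|_]; first lia.
Qed.

(** Programs divide by negative numbers only, so a positive divisor is negated together with the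
    dividend, and a zero divisor leads to [CSkip], in agreement with a stuck machine. Shifts flip
    the parity [b] to [1 - b]. *)
Definition stepc (q : label N) : cmd R :=
  match node_at q with
  | Const i a q' => CSeq (setc t2 a) (CSeq (put i t2) (setc rQ (enum_rank q')%:R))
  | Arith Div i j k q' =>
      let fin := CSeq (put i t2) (setc rQ (enum_rank q')%:R) in
      CSeq (get j t2) (CSeq (get k t3)
        (ifr t3
          (CSeq (opc Mul t1 t3 (-1))
            (ifr t1 CSkip
              (CSeq (opc Mul t2 t2 (-1)) (CSeq (op Div t2 t2 t1) fin))))
          (CSeq (op Div t2 t2 t3) fin)))
  | Arith o i j k q' =>
      CSeq (get j t2) (CSeq (get k t3) (CSeq (op o t2 t2 t3)
        (CSeq (put i t2) (setc rQ (enum_rank q')%:R))))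
  | Branch i q1 q2 =>
      CSeq (get i t2) (ifr t2 (setc rQ (enum_rank q1)%:R) (setc rQ (enum_rank q2)%:R))
  | ShiftL q' =>
      CSeq (mvRn 16) (CSeq (opc Add rP rP 1)
        (CSeq (opc Mul rPar rPar (-1)) (CSeq (opc Add rPar rPar 1)
          (setc rQ (enum_rank q')%:R))))
  | ShiftR q' =>
      CSeq (mvLn 16) (CSeq (opc Defs.Sub rP rP 1)
        (CSeq (opc Mul rPar rPar (-1)) (CSeq (opc Add rPar rPar 1)
          (setc rQ (enum_rank q')%:R))))
  | Output => get 0 rV
  end.

Definition volatile : seq nat := [:: rQ; rP; rPar; rV; t0; t1; t2; t3].

Definition sim P rho h (c : label N * tape R) :=
  [/\ at_block P rho h, rho rQ = (enum_rank c.1)%:R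
    & c.2 = fun i => rep e ini h (P + i)].

Definition is_output (q : label N) := if node_at q is Output then true else false.

Lemma upd_shift P h i v :
  upd (fun i => rep e ini h (P + i)) i v = fun j => upd (rep e ini h) (P + i) v (P + j).
Proof. by apply/funext => j; rewrite /upd (inj_eq (addrI P)). Qed.

Lemma stepc_den P rho h q w : sim P rho h (q, w) -> exists P' rho' h',
  [/\ den (stepc q) (phys (16 * P) rho h) = phys (16 * P') rho' h',
      sim P' rho' h' (step (q, w)), stamps e h -> stamps e h',
      keep volatile rho rho' &
      rho' rV = if is_output q then w 0 else rho rV] /\ (`|P'| <= `|P| + 1)%N.
Proof.
move=> [A Q /= ->]; have [G Ee EP Epar] := A; have [gn gm gl gf] := G.
rewrite /stepc /step /is_output.
have fin rho2 i q' v : at_block P rho2 h -> keep volatile rho rho2 ->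
    rho2 rV = rho rV -> rho2 t2 = v ->
  exists P' rho' h',
  [/\ den (CSeq (put i t2) (setc rQ (enum_rank q')%:R)) (phys (16 * P) rho2 h) =
        phys (16 * P') rho' h',
      sim P' rho' h' (q', upd (fun i => rep e ini h (P + i)) i v),
      stamps e h -> stamps e h',
      keep volatile rho rho' & rho' rV = rho rV] /\ (`|P'| <= `|P| + 1)%N.
  move=> A2 k2 V2 v2; have [[g1 g2 g3 g4] E2 EP2 Epar2] := A2.
  have [h' [E [r' [f' s']]]] := den_put i P h (isT : (t2 < 15)%N) E2.
  exists P, (upr rho2 rQ (enum_rank q')%:R), h'; split; last lia.
  split=> //; first by rewrite den_seq E den_setc.
  - split=> //; first by split=> //; split=> //; exact: f'.
    by rewrite upd_shift r' v2.
  - exact: keep_upr.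
have sub3 r : r \in volatile -> {subset [:: t0; t1; r] <= volatile}.
  by move=> rv x; rewrite in_cons in_cons mem_seq1 => /or3P[/eqP->|/eqP->|/eqP->].
case E: (node_at q) => [i a q'|o i j k q'|i q1 q2|q'|q'|]; lazy beta iota.
- rewrite den_seq den_setc //; apply: fin => //.
  exact: keep_upr.
- have [rho1 [E1 [v1 k1]]] := den_get j (isT : (t2 < 15)%N) A.
  have A1 : at_block P rho1 h by apply: at_block_keep A k1 isT.
  have [rho2 [E2 [v2 k2]]] := den_get k (isT : (t3 < 15)%N) A1.
  have A2 : at_block P rho2 h by apply: at_block_keep A1 k2 isT.
  have k12 : keep volatile rho rho2.
    by apply: keep_trans (keep_sub _ k1) (keep_sub _ k2); exact: sub3.
  have V2 : rho2 rV = rho rV by rewrite k2 ?k1.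
  have w2 : rho2 t2 = rep e ini h (P + j) by rewrite k2.
  have simple v : exists P' rho' h',
      [/\ den (CSeq (put i t2) (setc rQ (enum_rank q')%:R))
            (phys (16 * P) (upr rho2 t2 v) h) = phys (16 * P') rho' h',
          sim P' rho' h' (q', upd (fun i => rep e ini h (P + i)) i v),
          stamps e h -> stamps e h',
          keep volatile rho rho' & rho' rV = rho rV] /\ (`|P'| <= `|P| + 1)%N.
    by apply: fin => //; exact: keep_upr.
  rewrite -w2 -v2; case: o E => E; lazy beta iota; rewrite den_seq E1 den_seq E2;
    try by rewrite den_seq den_op //; exact: simple.
  rewrite den_ifr // /arith_eval; case: (leP 0 (rho2 t3)) => [b0|b0]; last first.
    by rewrite den_seq den_op // /arith_rho (lt_geF b0) (lt_eqF b0); exact: simple.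
  rewrite den_seq den_opc // den_ifr //; set rho3 := upr rho2 t1 _.
  have k3 : keep [:: t1] rho2 rho3 by apply: keep_upr.
  have A3 : at_block P rho3 h by apply: at_block_keep A2 k3 isT.
  have -> : rho3 t1 = - rho2 t3 by rewrite /rho3 /upr eqxx mulrN1.
  (* A divisor that is neither negative nor positive is zero: [step] leaves the configuration as it
     is, and so does the program. *)
  rewrite oppr_ge0; case: (leP (rho2 t3) 0) => [b1|b1].
    have -> : rho2 t3 == 0 by rewrite eq_le b0 b1.
    exists P, rho3, h; split; last lia.
    split=> //; last exact: keep_upr.
    by split=> //; rewrite k3 ?k2 ?k1.
  rewrite (gt_eqF b1) den_seq den_opc // den_seq den_op // /arith_rho.
  set rho4 := upr rho3 t2 _.
  have -> : rho4 t1 = - rho2 t3 by rewrite /rho4 /rho3 /upr /= mulrN1.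
  rewrite oppr_ge0 (lt_geF b1); lazy beta iota; apply: fin.
  + apply: (at_block_keep (l := [:: t2]) A3) => //.
    by do 2!apply: keep_upr => //.
  + by do 3!apply: keep_upr => //.
  + by [].
  + by rewrite /rho4 /rho3 /upr /= mulrN1 invrN mulrNN.
- have [rho1 [E1 [v1 k1]]] := den_get i (isT : (t2 < 15)%N) A.
  have A1 : at_block P rho1 h by apply: at_block_keep A k1 isT.
  have k1' : keep volatile rho rho1 by apply: keep_sub k1; exact: sub3.
  rewrite den_seq E1 den_ifr // v1.
  have goto q0 : exists P' rho' h',
      [/\ phys (16 * P) (upr rho1 rQ (enum_rank q0)%:R) h = phys (16 * P') rho' h',
          sim P' rho' h' (q0, fun i => rep e ini h (P + i)),
          stamps e h -> stamps e h',
          keep volatile rho rho' & rho' rV = rho rV] /\ (`|P'| <= `|P| + 1)%N.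
    exists P, (upr rho1 rQ (enum_rank q0)%:R), h; split; last lia.
    split; [by []| |by []|exact: keep_upr|by rewrite /upr /= k1].
    split; [|by []|by []].
    by apply: (at_block_keep (l := [:: rQ]) A1) => //; apply: keep_upr.
  by case: (0 <= _); rewrite den_setc //; exact: goto.
- rewrite den_seq den_mvRn 3!den_seq !den_opc // den_setc //.
  set rho1 := upr _ rQ _; exists (P + 1), rho1, h; split; last lia.
  have -> : 16 * P + 16%:Z = 16 * (P + 1) by lia.
  split; [by []| |by []|by do 4!apply: keep_upr => //|by []].
  split; [|by []|by apply/funext => i /=; congr rep; lia].
  split; [by []|by []|by rewrite /rho1 /upr /= EP intrD|].
  have -> : ((P + 1) %% 2)%Z = (P %% 2)%Z * (-1) + 1 by lia.
  by rewrite intrD intrM /rho1 /upr /= Epar.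
- rewrite den_seq den_mvLn 3!den_seq !den_opc // den_setc //.
  set rho1 := upr _ rQ _; exists (P - 1), rho1, h; split; last lia.
  have -> : 16 * P - 16%:Z = 16 * (P - 1) by lia.
  split; [by []| |by []|by do 4!apply: keep_upr => //|by []].
  split; [|by []|by apply/funext => i /=; congr rep; lia].
  split; [by []|by []|by rewrite /rho1 /upr /= EP intrB|].
  have -> : ((P - 1) %% 2)%Z = (P %% 2)%Z * (-1) + 1 by lia.
  by rewrite intrD intrM /rho1 /upr /= Epar.
- have [rho1 [E1 [v1 k1]]] := den_get 0 (isT : (rV < 15)%N) A.
  exists P, rho1, h; split; last lia.
  split=> //; last by apply: keep_sub k1; exact: sub3.
  split=> //; last by rewrite k1.
  by apply: at_block_keep A k1 isT.
Qed.

(** The only test available is a sign test; equality of the current rank with a given one is tested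
    as nonnegativity of the opposite of the squared difference. *)
Fixpoint dispatch (l : seq (label N)) : cmd R :=
  if l is q :: l' then
    CSeq (opc Defs.Sub t0 rQ (enum_rank q)%:R) (CSeq (op Mul t0 t0 t0)
      (CSeq (opc Mul t0 t0 (-1)) (ifr t0 (stepc q) (dispatch l'))))
  else CSkip.

Lemma dispatch_den l q P rho h : q \in l -> rho rQ = (enum_rank q)%:R ->
  exists rho', den (dispatch l) (phys P rho h) = den (stepc q) (phys P rho' h) /\
    keep [:: t0] rho rho'.
Proof.
elim: l rho => // q' l IH rho ql Q; rewrite [dispatch _]/= 3!den_seq.
rewrite den_opc // den_op // den_opc // den_ifr //.
set rho1 := upr (arith_rho _ _ _ _ _) _ _.
have k1 : keep [:: t0] rho rho1 by do 3!apply: keep_upr => //.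
have -> : rho1 t0 = - ((enum_rank q)%:R - (enum_rank q')%:R) ^+ 2.
  by rewrite /rho1 /arith_rho /upr /= Q mulrN1 expr2.
rewrite oppr_ge0; have -> :
    ((enum_rank q)%:R - (enum_rank q')%:R) ^+ 2 <= 0 :> R = (q == q').
  rewrite le_eqVlt sqrf_eq0 subr_eq0 eqr_nat ltNge sqr_ge0 orbF.
  by apply/eqP/eqP => [/ord_inj/enum_rank_inj|->].
case: (eqVneq q q') ql => [<- _|qq]; first by exists rho1.
rewrite inE (negbTE qq) => ql; have [|rho2 [-> k2]] := IH rho1 ql; first by rewrite k1.
by exists rho2; split=> //; apply: keep_trans k1 k2.
Qed.

Lemma loopfree_dispatch l : loopfree (dispatch l).
Proof.
elim: l => //= q l ->; rewrite andbT /stepc.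
case: (node_at q) => [i a q'|o i j k q'|i q1 q2|q'|q'|];
  rewrite /= ?loopfree_mvRn ?loopfree_mvLn ?initc_free //.
by case: o; rewrite /= !initc_free.
Qed.

Definition sim_step : cmd R := dispatch (enum (label N)).

Lemma sim_step_den P rho h c : sim P rho h c -> exists P' rho' h',
  [/\ execb sim_step (phys (16 * P) rho h) (cost sim_step) (phys (16 * P') rho' h'),
      sim P' rho' h' (step c), stamps e h -> stamps e h',
      keep volatile rho rho' &
      rho' rV = if is_output c.1 then c.2 0 else rho rV] /\ (`|P'| <= `|P| + 1)%N.
Proof.
case: c => q w S; have [A /= Q W] := S.
have qe : q \in enum (label N) by rewrite mem_enum.
have [rho1 [E1 k1]] := dispatch_den (16 * P) h qe Q.
have S1 : sim P rho1 h (q, w).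
  by split=> //=; [apply: at_block_keep A k1 isT|rewrite k1].
have [P' [rho' [h' [[E' S' st k2 V] PP]]]] := stepc_den S1.
exists P', rho', h'; split=> //; split=> //.
- by rewrite -E' -E1; apply: den_exec; exact: loopfree_dispatch.
- apply: keep_trans (keep_sub _ k1) k2 => x; rewrite !inE => ->.
  by rewrite !orbT.
- by rewrite V k1.
Qed.

Definition sim_body : cmd R := CSeq sim_step (opc Defs.Sub rC rC 1).
Definition sim_loop : cmd R := whiler rC sim_body.

(** A guard holds at 0, so a clock that allows [T] rounds starts at [T - 1]. The bound on the drift
    of the head pays for the later return to the origin. *)
Lemma sim_loop_exec T P rho h c : sim P rho h c -> rho rC = T%:R - 1 ->
  exists P' rho' h',
  [/\ execb sim_loop (phys (16 * P) rho h) (T * (cost sim_body).+1 + 1)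
        (phys (16 * P') rho' h'),
      sim P' rho' h' (iter T (@step R N) c), stamps e h -> stamps e h' &
      keep (rC :: volatile) rho rho'] /\ (`|P'| <= `|P| + T)%N.
Proof.
elim: T P rho h c => [|T IH] P rho h c S C.
  exists P, rho, h; split; last lia.
  split=> //; rewrite mul0n; apply: execb_while_end.
  by rewrite phys_reg // C sub0r oppr_ge0 ler10.
have [P1 [rho1 [h1 [[E1 S1 st1 k1 _] PP1]]]] := sim_step_den S.
have C1 : rho1 rC = T.+1%:R - 1 by rewrite k1.
set rho2 := upr rho1 rC (T%:R - 1).
have S2 : sim P1 rho2 h1 (step c).
  by have [A Q W] := S1; split.
have [P3 [rho3 [h3 [[E3 S3 st3 k3] PP3]]]] := IH _ _ _ _ S2 erefl.
exists P3, rho3, h3; split; last lia.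
split; [|by rewrite iterSr|by move=> /st1/st3|].
- rewrite mulSn -addnA addSn; apply: (execb_while (s2 := phys (16 * P1) rho2 h1)) E3.
    by rewrite phys_reg // C subr_ge0 ler1n.
  apply: execb_seq E1 _; have -> : rho2 = upr rho1 rC (rho1 rC - 1).
    by rewrite /rho2 C1; congr upr; rewrite -natr1 addrK.
  by apply: exec_den => //; rewrite den_opc.
- apply: keep_trans k3; apply: keep_upr => //.
  by apply: keep_sub k1 => x xv; rewrite in_cons xv orbT.
Qed.

(** * Return of the head to the origin *)

Definition homeL : cmd R :=
  CSeq (mvLn 16) (CSeq (opc Defs.Sub rP rP 1) (opc Defs.Sub t0 rP 1)).
Definition homeR : cmd R :=
  CSeq (mvRn 16) (CSeq (opc Add rP rP 1)
    (CSeq (opc Mul t0 rP (-1)) (opc Defs.Sub t0 t0 1))).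
(** One loop for each sign of the position. The loop for the wrong sign fails its guard at once, and
    so does the second loop when the first one has reached the origin. *)
Definition home : cmd R :=
  CSeq (opc Defs.Sub t0 rP 1) (CSeq (whiler t0 homeL)
    (CSeq (CSeq (opc Mul t0 rP (-1)) (opc Defs.Sub t0 t0 1)) (whiler t0 homeR))).

Lemma homeL_exec n rho h : rho rP = n%:R -> rho t0 = n%:R - 1 -> exists rho',
  [/\ execb (whiler t0 homeL) (phys (16 * n%:Z) rho h) (n * (cost homeL).+1 + 1)
        (phys 0 rho' h), rho' rP = 0 & keep [:: t0; rP] rho rho'].
Proof.
elim: n rho => [|n IH] rho EP E0.
  exists rho; split=> //; rewrite mul0n; apply: execb_while_end.
  by rewrite phys_reg // E0 sub0r oppr_ge0 ler10.
pose rho1 := upr (upr rho rP n%:R) t0 (n%:R - 1).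
have [rho' [E' P' k']] := IH rho1 erefl erefl.
exists rho'; split=> //; last by apply: keep_trans k'; do 2!apply: keep_upr => //.
rewrite mulSn -addnA addSn; apply: execb_while E'.
  by rewrite phys_reg // E0 subr_ge0 ler1n.
have -> : phys (16 * n%:Z) rho1 h = den homeL (phys (16 * n.+1%:Z) rho h).
  rewrite /homeL den_seq den_mvLn den_seq !den_opc //.
  have -> : 16 * n.+1%:Z - 16%:Z = 16 * n%:Z by lia.
  have -> : rho rP - 1 = n%:R by rewrite EP -natr1 addrK.
  by [].
exact: den_exec.
Qed.

Lemma homeR_exec n rho h : rho rP = - n%:R -> rho t0 = n%:R - 1 -> exists rho',
  [/\ execb (whiler t0 homeR) (phys (- (16 * n%:Z)) rho h) (n * (cost homeR).+1 + 1)
        (phys 0 rho' h), rho' rP = 0 & keep [:: t0; rP] rho rho'].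
Proof.
elim: n rho => [|n IH] rho EP E0.
  exists rho; split=> //; last by rewrite EP oppr0.
  rewrite mul0n oppr0; apply: execb_while_end.
  by rewrite phys_reg // E0 sub0r oppr_ge0 ler10.
pose rho1 := upr (upr (upr rho rP (- n%:R)) t0 n%:R) t0 (n%:R - 1).
have [rho' [E' P' k']] := IH rho1 erefl erefl.
exists rho'; split=> //; last by apply: keep_trans k'; do 3!apply: keep_upr => //.
rewrite mulSn -addnA addSn; apply: execb_while E'.
  by rewrite phys_reg // E0 subr_ge0 ler1n.
have -> : phys (- (16 * n%:Z)) rho1 h = den homeR (phys (- (16 * n.+1%:Z)) rho h).
  rewrite /homeR den_seq den_mvRn 2!den_seq !den_opc //.
  have -> : - (16 * n.+1%:Z) + 16%:Z = - (16 * n%:Z) by lia.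
  have -> : rho rP + 1 = - n%:R by rewrite EP -natr1 opprD addrNK.
  by rewrite {2}/upr /= mulrN1 opprK.
exact: den_exec.
Qed.

Definition home_cost := (cost homeL + cost homeR + 100)%N.

Lemma home_exec P rho h : rho rP = P%:~R -> exists rho',
  execb home (phys (16 * P) rho h) (home_cost * (`|P| + 1)) (phys 0 rho' h) /\
  keep [:: t0; rP] rho rho'.
Proof.
move=> EP.
have st0 rho1 : execb (opc Defs.Sub t0 rP 1) (phys (16 * P) rho1 h) 10
   (phys (16 * P) (upr rho1 t0 (rho1 rP - 1)) h).
  by apply: exec_den => //; rewrite den_opc.
have st1 Q rho1 : execb (CSeq (opc Mul t0 rP (-1)) (opc Defs.Sub t0 t0 1))
   (phys Q rho1 h) 10 (phys Q (upr (upr rho1 t0 (- rho1 rP)) t0 (- rho1 rP - 1)) h).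
  by apply: exec_den => //; rewrite den_seq !den_opc //= mulrN1.
case: (lerP 0 P) => P0.
  have [n En] : exists n : nat, P = n%:Z by exists `|P|%N; lia.
  have E1 : (upr rho t0 (rho rP - 1)) rP = n%:R by rewrite /upr /= EP En.
  have E2 : (upr rho t0 (rho rP - 1)) t0 = n%:R - 1 by rewrite /upr /= EP En.
  have [rho1 [X1 P1 k1]] := homeL_exec h E1 E2; rewrite -En in X1.
  exists (upr (upr rho1 t0 (- rho1 rP)) t0 (- rho1 rP - 1)); split; last first.
    by do 2!apply: keep_upr => //; apply: keep_trans k1; apply: keep_upr.
  apply: execb_le (execb_seq (st0 rho) (execb_seq X1 (execb_seq (st1 0 rho1)
    (execb_while_end _ _)))); last first.
    by rewrite phys_reg // /upr /= P1 oppr0 sub0r oppr_ge0 ler10.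
  rewrite /home_cost; nia.
have [n En] : exists n : nat, P = - n%:Z by exists `|P|%N; lia.
have EP' : rho rP = - n%:R by rewrite EP En intrN.
pose rho1 := upr rho t0 (rho rP - 1).
pose rho2 := upr (upr rho1 t0 (- rho1 rP)) t0 (- rho1 rP - 1).
have E1 : rho2 rP = - n%:R by rewrite /rho2 /rho1 /upr /= EP'.
have E2 : rho2 t0 = n%:R - 1 by rewrite /rho2 /rho1 /upr /= EP' opprK.
have [rho3 [X1 P1 k1]] := homeR_exec h E1 E2; rewrite -mulrN -En in X1.
exists rho3; split; last first.
  by apply: keep_trans k1; do 3!apply: keep_upr => //.
have W : execb (whiler t0 homeL) (phys (16 * P) rho1 h) 1 (phys (16 * P) rho1 h).
  apply: execb_while_end; rewrite phys_reg // -ltNge /rho1 /upr /= EP'.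
  by have := ler0n R n; lra.
apply: execb_le (execb_seq (st0 rho) (execb_seq W (execb_seq (st1 _ rho1) X1))).
by rewrite /home_cost; nia.
Qed.

(** After the clock has run out, [rV] is cleared and one more step is simulated: at an output node
    it changes nothing but copies cell 0 to [rV], at any other node it leaves [rV] at 0. A timeout
    thus reads as NO. *)
Definition simulate : cmd R :=
  CSeq (CSeq (setc rP 0) (CSeq (setc rPar 0) (setc rQ (enum_rank (start N))%:R)))
    (CSeq sim_loop (CSeq (setc rV 0) (CSeq sim_step home))).

Definition sim_cost := (cost sim_body + cost sim_step + home_cost + home_cost + 10)%N.

Lemma simulate_exec T rho h : good rho h -> rho rE = e -> rho rC = T%:R - 1 ->
  exists rho' h',
  [/\ execb simulate (phys 0 rho h) (sim_cost * (T + 1)) (phys 0 rho' h'),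
      good rho' h', stamps e h -> stamps e h', keep (rC :: volatile) rho rho' &
      rho' rV = if halted N (rep e ini h) T then (run N (rep e ini h) T).2 0 else 0].
Proof.
move=> [g1 g2 g3 g4] Ee C.
pose rho1 := upr (upr (upr rho rP 0) rPar 0) rQ (enum_rank (start N))%:R.
have A1 : at_block 0 rho1 h by split.
have S1 : sim 0 rho1 h (start N, rep e ini h).
  by split=> //; apply/funext => i; rewrite add0r.
have k1 : keep (rC :: volatile) rho rho1 by do 3!apply: keep_upr => //.
have [P2 [rho2 [h2 [[E2 S2 st2 k2] PP2]]]] := sim_loop_exec S1 (C : rho1 rC = _).
have S3 : sim P2 (upr rho2 rV 0) h2 (run N (rep e ini h) T).
  by have [A Q W] := S2; split.
have [P4 [rho4 [h4 [[E4 S4 st4 k4 V4] PP4]]]] := sim_step_den S3.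
have [[[f1 f2 f3 f4] A5 A6 A7] _ _] := S4.
have [rho5 [E5 k5]] := home_exec h4 A6.
exists rho5, h4; split=> //.
- have X1 : execb (CSeq (setc rP 0) (CSeq (setc rPar 0)
      (setc rQ (enum_rank (start N))%:R))) (phys 0 rho h) 3 (phys (16 * 0) rho1 h).
    by apply: exec_den => //; rewrite 2!den_seq !den_setc.
  have X3 : execb (setc rV 0) (phys (16 * P2) rho2 h2) 1
      (phys (16 * P2) (upr rho2 rV 0) h2).
    by apply: exec_den => //; rewrite den_setc.
  apply: execb_le (execb_seq X1 (execb_seq E2 (execb_seq X3 (execb_seq E4 E5)))).
  (* The extra step may move the head once more, so the drift is at most [T + 1]; this is why
     [home_cost] occurs twice in [sim_cost]. *)
  have : (home_cost * (`|P4| + 1) <= home_cost * (T + 2))%N.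
    by rewrite leq_mul2l; apply/orP; right; lia.
  by rewrite /sim_cost; nia.
- by split; rewrite ?k5.
- by move=> /st2/st4.
- apply: keep_trans k1 _; apply: keep_trans k2 _.
  apply: (@keep_trans _ _ _ (upr rho2 rV 0)); first exact: keep_upr.
  apply: keep_trans (keep_sub _ k4) (keep_sub _ k5) => x.
    by move=> xv; rewrite in_cons xv orbT.
  by rewrite !inE => /orP[] ->; rewrite ?orbT.
- by rewrite k5 // V4 /is_output /halted.
Qed.

End Simulation.

(** * Preparation of the tape *)

Section Preparation.
Variable R : realType.
Implicit Types (s h : tape R) (rho : nat -> R) (P : int) (x : seq R).

Definition repeat_mv (mv : cmd R) : cmd R := whiler rT (CSeq mv (opc Defs.Sub rT rT 1)).

Lemma repeat_mv_exec mv d n P rho h :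
  loopfree mv -> (forall P rho h, den mv (phys P rho h) = phys (P + d) rho h) ->
  rho rT = n%:R - 1 -> exists rho',
  execb (repeat_mv mv) (phys P rho h) (n * (cost mv + 10) + 1)
    (phys (P + d * n%:Z) rho' h) /\ keep [:: rT] rho rho'.
Proof.
move=> lf dm; elim: n P rho => [|n IH] P rho E.
  exists rho; split=> //; rewrite mulr0 addr0 mul0n; apply: execb_while_end.
  by rewrite phys_reg // E sub0r oppr_ge0 ler10.
have E1 : upr rho rT (rho rT - 1) rT = n%:R - 1 by rewrite /upr eqxx E -natr1 addrK.
have [rho' [E' k']] := IH (P + d) _ E1.
exists rho'; split; last by apply: keep_trans k'; exact: keep_upr.
have -> : P + d * n.+1%:Z = P + d + d * n%:Z by lia.
apply: (execb_le (T := (cost mv + 4 + (n * (cost mv + 10) + 1)).+1)).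
  by nia.
apply: execb_while E'; first by rewrite phys_reg // E subr_ge0 ler1n.
apply: exec_den; [by rewrite /= lf|by rewrite leq_add2l|].
by rewrite den_seq dm den_opc.
Qed.

Definition go (mv : cmd R) : cmd R := CSeq (opc Defs.Sub rT rI 1) (repeat_mv mv).

Lemma go_exec mv d n P rho h :
  loopfree mv -> (forall P rho h, den mv (phys P rho h) = phys (P + d) rho h) ->
  rho rI = n%:R -> exists rho',
  execb (go mv) (phys P rho h) (n * (cost mv + 10) + 5)
    (phys (P + d * n%:Z) rho' h) /\ keep [:: rT] rho rho'.
Proof.
move=> lf dm E.
have E1 : upr rho rT (rho rI - 1) rT = n%:R - 1 by rewrite /upr eqxx E.
have [rho' [E' k']] := repeat_mv_exec P h lf dm E1.
exists rho'; split; last by apply: keep_trans k'; exact: keep_upr.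
apply: (execb_le (T := 4 + (n * (cost mv + 10) + 1))); first lia.
by apply: execb_seq E'; apply: exec_den => //; rewrite den_opc.
Qed.

(** The entry at [p] travels to [S * p] in register [t2]. Each of the three walks repeats a fixed
    move [p] times, with strides 1, [S - 1] and [- S], which sum to zero. *)
Definition spread_body (S : nat) : cmd R :=
  CSeq (go mvR) (CSeq (CSeq (load t2 0) (CSeq (setc t0 0) (store 0 t0)))
  (CSeq (go (mvRn S.-1)) (CSeq (store 0 t2)
  (CSeq (go (mvLn S)) (opc Defs.Sub rI rI 1))))).

(* In descending order, so that no cell is overwritten before it has been moved. *)
Definition spread (S : nat) : cmd R :=
  CSeq (opc Defs.Sub rI rN 1) (whiler rI (spread_body S)).

(** Loop invariant: entries of index at least [p] have been moved, the others are still in place. *)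
Definition spread_tape (S : nat) x h (p : nat) : tape R := fun i =>
  match i with
  | Posz b => if (b < p)%N then x`_b else
              if (S %| b)%N && (p <= b %/ S)%N then x`_(b %/ S) else 0
  | Negz j => h (Negz j)
  end.

(** The order of the updates matters at [p = 0], where source and target coincide: the outer write
    restores what the inner one cleared. *)
Lemma spread_tapeS S x h p : (1 < S)%N ->
  upd (upd (spread_tape S x h p.+1) p%:Z 0) (S * p)%N%:Z x`_p = spread_tape S x h p.
Proof.
move=> S1; apply/funext => -[b|j]; rewrite /upd //=.
rewrite -[Posz b == _]/(b == (S * p)%N) -[Posz b == p%:Z]/(b == p).
case: (eqVneq b (S * p)%N) => [->|bS].
  rewrite dvdn_mulr // mulKn ?leqnn; last lia.
  by case: ltnP => //; nia.
case: (eqVneq b p) bS => [->|bp] bS.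
  rewrite ltnn; case: (posnP p) => [p0|p0]; first by move: bS; rewrite p0 muln0 eqxx.
  by rewrite [(p <= _)%N]leqNgt ltn_Pdiv // andbF.
rewrite ltnS [(b <= p)%N]leq_eqVlt (negbTE bp) /=.
case: ltnP => // pb; case: (boolP (S %| b)%N) => //= /dvdnP[k Ek].
move: bS; rewrite Ek mulnK; last lia.
rewrite mulnC eqn_pmul2l; last lia.
by move=> kp; have -> : (p < k)%N = (p <= k)%N by lia.
Qed.

Lemma spread_body_exec S x h p rho : (1 < S)%N -> rho rI = p%:R -> exists rho',
  [/\ execb (spread_body S) (phys 0 rho (spread_tape S x h p.+1))
     ((cost (mvR : cmd R) + cost (mvRn S.-1 : cmd R) + cost (mvLn S : cmd R) + 70) * (p + 1))
     (phys 0 rho' (spread_tape S x h p)), rho' rI = p%:R - 1 &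
     keep [:: rI; rT; t0; t2] rho rho'].
Proof.
move=> S1 E.
have [rho1 [E1 k1]] := @go_exec mvR 1 p 0 rho (spread_tape S x h p.+1) isT
   (@den_mvR R) E.
rewrite add0r mul1r in E1.
pose h1 := upd (spread_tape S x h p.+1) p%:Z 0.
pose rho2 := upr (upr rho1 t2 x`_p) t0 0.
have E2 : execb (CSeq (load t2 0) (CSeq (setc t0 0) (store 0 t0)))
    (phys p rho1 (spread_tape S x h p.+1)) 20 (phys p rho2 h1).
  apply: exec_den => //; rewrite 2!den_seq den_load // den_setc // den_store //.
  by rewrite addr0 /= leqnn.
have E2' : rho2 rI = p%:R by rewrite /rho2 /upr /= k1.
have [rho3 [E3 k3]] := @go_exec (mvRn S.-1) S.-1 p p rho2 h1 (loopfree_mvRn _ _)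
   (@den_mvRn R S.-1) E2'.
have Ep : p%:Z + S.-1%:Z * p%:Z = (S * p)%N%:Z.
  have -> : S.-1%:Z = S%:Z - 1 by lia.
  by rewrite PoszM; ring.
rewrite Ep in E3.
have E4 : execb (store 0 t2) (phys (S * p)%N rho3 h1) 20
   (phys (S * p)%N rho3 (spread_tape S x h p)).
  apply: exec_den => //; rewrite den_store // addr0 k3 // -(spread_tapeS _ _ _ S1).
  by [].
have E4' : rho3 rI = p%:R by rewrite k3.
have dL P rho0 h0 : den (mvLn S) (phys P rho0 h0) = phys (P + - (S%:Z)) rho0 h0.
  exact: den_mvLn.
have [rho5 [E5 k5]] := @go_exec (mvLn S) (- S%:Z) p (S * p)%N rho3
   (spread_tape S x h p) (loopfree_mvLn _ _) dL E4'.
have Ep' : (S * p)%N%:Z + - (S%:Z) * p%:Z = 0 by rewrite PoszM; ring.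
rewrite Ep' in E5.
exists (upr rho5 rI (p%:R - 1)); split.
- have E6 : execb (opc Defs.Sub rI rI 1) (phys 0 rho5 (spread_tape S x h p)) 10
     (phys 0 (upr rho5 rI (p%:R - 1)) (spread_tape S x h p)).
    by apply: exec_den => //; rewrite den_opc // k5 // E4'.
  apply: execb_le (execb_seq E1 (execb_seq E2 (execb_seq E3
     (execb_seq E4 (execb_seq E5 E6))))).
  by move: (cost _) (cost _) (cost _) => a b c; nia.
- by rewrite /upr eqxx.
- apply: keep_upr => //.
  apply: keep_trans (keep_sub _ k5); last by move=> i; rewrite !inE => /eqP->.
  apply: keep_trans (keep_sub _ k3); last by move=> i; rewrite !inE => /eqP->.
  do 2!apply: keep_upr => //.
  by apply: keep_sub k1 => i; rewrite !inE => /eqP->.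
Qed.

Definition spread_cost S :=
  (cost (mvR : cmd R) + cost (mvRn S.-1 : cmd R) + cost (mvLn S : cmd R) + 80)%N.

Lemma spread_exec S x h rho : (1 < S)%N -> rho rN = (size x)%:R ->
  (forall k : nat, h k = x`_k) -> exists rho',
  execb (spread S) (phys 0 rho h) (spread_cost S * (size x + 1) ^ 2)
    (phys 0 rho' (spread_tape S x h 0)) /\ keep [:: rI; rT; t0; t2] rho rho'.
Proof.
move=> S1 En hx.
have -> : phys 0 rho h = phys 0 rho (spread_tape S x h (size x)).
  congr phys; apply/funext => -[b|j] //=; rewrite hx.
  case: ltnP => // nb; rewrite nth_default //.
  by case: ifP => // /andP[_ nbS]; rewrite nth_default.
have loop p rho1 : rho1 rI = p%:R - 1 -> exists rho2,
    execb (whiler rI (spread_body S)) (phys 0 rho1 (spread_tape S x h p))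
     (p * (spread_cost S * (p + 1)) + 1) (phys 0 rho2 (spread_tape S x h 0)) /\
    keep [:: rI; rT; t0; t2] rho1 rho2.
  elim: p rho1 => [|p IH] rho1 E1.
    exists rho1; split=> //; rewrite mul0n; apply: execb_while_end.
    by rewrite phys_reg // E1 sub0r oppr_ge0 ler10.
  have E1' : rho1 rI = p%:R by rewrite E1 -natr1 addrK.
  have [rho2 [X2 E2 k2]] := spread_body_exec x h S1 E1'.
  have [rho3 [X3 k3]] := IH rho2 E2.
  exists rho3; split; last exact: keep_trans k2 k3.
  apply: execb_le (execb_while _ X2 X3).
    rewrite /spread_cost; move: (cost _) (cost _) (cost _) => a b c; nia.
  by rewrite phys_reg // E1 subr_ge0 ler1n.
have E1 : upr rho rI (rho rN - 1) rI = (size x)%:R - 1 by rewrite /upr eqxx En.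
have [rho2 [X2 k2]] := loop _ _ E1.
exists rho2; split; last by apply: keep_trans k2; apply: keep_upr.
have X1 : execb (opc Defs.Sub rI rN 1) (phys 0 rho (spread_tape S x h (size x))) 10
   (phys 0 (upr rho rI (rho rN - 1)) (spread_tape S x h (size x))).
  by apply: exec_den => //; rewrite den_opc.
apply: execb_le (execb_seq X1 X2).
rewrite /spread_cost; move: (cost _) (cost _) (cost _) => a b c; nia.
Qed.

Fixpoint power (r d : nat) : cmd R :=
  if d is d'.+1 then CSeq (power r d') (op Mul rC rC t0) else CSkip.

(** The exponent is a constant of the program, so the clock is computed in constant time; the final
    decrement follows the convention that a loop of [T] rounds starts at [T - 1]. *)
Definition set_clock (r c d : nat) : cmd R :=
  CSeq (CSeq (setc rC c%:R) (opc Add t0 r 1)) (CSeq (power r d) (opc Defs.Sub rC rC 1)).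

Lemma loopfree_power r d : loopfree (power r d).
Proof. by elim: d => //= d ->. Qed.

Lemma den_power r d P rho h :
  den (power r d) (phys P rho h) =
  phys P (upr rho rC (rho rC * rho t0 ^+ d)) h.
Proof.
elim: d => [|d IH].
  rewrite /= expr0 mulr1; congr phys; apply/funext => j; rewrite /upr.
  by case: eqP => [->|].
rewrite [power _ _]/= den_seq IH den_op // /arith_rho; congr phys.
apply/funext => j; rewrite /upr /=; case: eqP => // _.
by rewrite exprSr mulrA.
Qed.

Lemma set_clock_exec r c d P rho h : (r < 15)%N -> r != rC -> exists rho',
  [/\ execb (set_clock r c d) (phys P rho h) (cost (set_clock r c d)) (phys P rho' h),
      rho' rC = c%:R * (rho r + 1) ^+ d - 1 & keep [:: rC; t0] rho rho'].
Proof.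
move=> lr rC'; eexists; split.
- apply: exec_den => //; first by rewrite /= loopfree_power.
  rewrite /set_clock den_seq [X in den _ X]den_seq den_setc // den_opc //.
  by rewrite den_seq den_power den_opc.
- by rewrite /upr /= (negbTE rC').
- by do 4!apply: keep_upr => //.
Qed.

(** * Opening the gap and measuring the input *)

Definition begin_prog : cmd R :=
  CSeq (CArith Add (Negz 0) (Negz 0) (Negz 1)) (CArith Defs.Sub (Negz 1) (Negz 1) (Negz 0)).
(** The value 2 left in cell -1 is the sentinel of the way back: all cells further left hold at most
    1, so [1 - value] is negative there only. The value 1/2 put in that cell before starts the
    halving of the marks. *)
Definition mark_prog : cmd R :=
  CSeq (CArith Add (Negz 1) (Negz 1) (Negz 0)) (CSeq (CConst (Negz 0) (1 / 2))
  (CSeq CShR (CSeq CShR (CSeq (CArith Defs.Sub 0 0 1) (CConst 1 2))))).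
Definition walk_prog : cmd R := CWhile 0 (CSeq CShR (CArith Defs.Sub 0 0 1)).
Definition test_prog : cmd R := CSeq (load t0 0) (CSeq (opc Mul t0 t0 (-1)) (opc Add t0 t0 1)).
Definition count_prog : cmd R :=
  whiler t0 (CSeq (opc Add rN rN 1) (CSeq mvR test_prog)).

(* Opens a gap of registers in the zeros left of the marks of [input x], walks
   back to the origin and leaves the length of [x] in [rN]. The first two
   operations turn cell -2 into the opposite of cell -1, so that it can be
   tested without a free cell; while walking left, each mark is halved by
   subtracting its right neighbour, so that the first blank turns negative. *)
Definition open_gap : cmd R :=
  CSeq begin_prog (CIf (Negz 1) CSkip
    (CSeq mark_prog (CSeq walk_prog (CSeq test_prog (CSeq count_prog mvR))))).

(** The head is at [Negz k]: the marks already passed are halved, and the current cell has just lost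
    1/2. *)
Definition walk_tape x (k : nat) : tape R := fun i =>
  match i with
  | Posz a => x`_a
  | Negz j => if j == 0%N then 2 else if (j < k)%N then 1 / 2 else
              if j == k then (k < size x)%N%:R - 1 / 2 else (j < size x)%N%:R
  end.

Lemma walk_exec x k : (0 < k <= size x)%N ->
  execb walk_prog (fun i => walk_tape x k (i + Negz k)) ((size x - k) * 10 + 1)
    (fun i => walk_tape x (size x) (i + Negz (size x))).
Proof.
move=> /andP[k0 kn]; move En: (size x - k)%N => n.
elim: n k k0 kn En => [|n IH] k k0 kn En.
  have -> : k = size x by lia.
  rewrite mul0n; apply: execb_while_end; rewrite add0r /walk_tape eqxx !ltnn.
  by case: eqP => [|_]; [lia|rewrite /= -ltNge; lra].
have kn' : (k < size x)%N by lia.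
have X := IH k.+1 isT kn' ltac:(lia).
apply: execb_le (execb_while (T1 := 3) _ _ X); first lia.
  rewrite add0r /walk_tape eqxx ltnn kn'; case: eqP => [|_]; first lia.
  by rewrite /=; lra.
apply: exec_den => //; apply/funext => i.
rewrite den_seq /den /arith_den /upd; cbv beta.
have E a : a - 1 + Negz k = a + Negz k.+1 by rewrite -addrA [-1 + _]addrC Negz_sub1.
rewrite !E; case: eqP => [->|i0].
  have -> : (1 + Negz k.+1 = Negz k) by rewrite addrC Negz_add1.
  rewrite !add0r /walk_tape !eqxx !ltnn kn'.
  have -> : (k.+1 < k)%N = false by lia.
  have -> : (k.+1 == k) = false by apply/eqP; lia.
  case: eqP => [|_]; first lia.
  by case: eqP => [|_]; [lia|rewrite /=; lra].
have [[a ->]|[j Ej]] :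
    (exists a : nat, i + Negz k.+1 = a) \/ (exists j, i + Negz k.+1 = Negz j).
- by case: (i + Negz k.+1) => j; [left|right]; exists j.
- by [].
rewrite Ej /walk_tape.
have jk : j <> k.+1 by move: Ej; rewrite !NegzE; lia.
case: eqP => // _; case: (eqVneq j k) => [->|jk'].
  by rewrite ltnn leqnn kn' /=; lra.
have -> : (j < k.+1)%N = (j < k)%N by lia.
by case: ltnP => // _; case: eqP.
Qed.

Lemma test_exec P rho h : execb test_prog (phys P rho h) 20
  (phys P (upr rho t0 (1 - h P)) h).
Proof.
apply: exec_den => //; rewrite 2!den_seq den_load // !den_opc // addr0.
congr phys; apply/funext => j; rewrite /upr /=; case: eqP => // _.
by rewrite mulrN1 addrC.
Qed.

Lemma count_exec x m rho : (m <= size x)%N -> rho t0 = 1 - walk_tape x (size x) (Negz m) ->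
  exists rho', [/\ execb count_prog (phys (Negz m) rho (walk_tape x (size x)))
     (m * (cost (mvR : cmd R) + 30) + 1) (phys (Negz 0) rho' (walk_tape x (size x))) &
     rho' rN = rho rN + m%:R].
Proof.
elim: m rho => [|m IH] rho mn E.
  exists rho; split; rewrite ?addr0 // mul0n; apply: execb_while_end.
  by rewrite phys_reg // E /= -ltNge; lra.
pose rho1 := upr (upr rho rN (rho rN + 1)) t0 (1 - walk_tape x (size x) (Negz m)).
have [rho2 [X2 E2]] := IH rho1 ltac:(lia) erefl.
exists rho2; split; last first.
  by rewrite E2 /rho1 /upr /= -natr1 -addrA [1 + _]addrC.
have X1 : execb (opc Add rN rN 1) (phys (Negz m.+1) rho (walk_tape x (size x))) 4
     (phys (Negz m.+1) (upr rho rN (rho rN + 1)) (walk_tape x (size x))).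
  by apply: exec_den => //; rewrite den_opc.
have Xm : execb mvR (phys (Negz m.+1) (upr rho rN (rho rN + 1)) (walk_tape x (size x)))
    (cost (mvR : cmd R))
    (phys (Negz m) (upr rho rN (rho rN + 1)) (walk_tape x (size x))).
  by apply: exec_den => //; rewrite den_mvR Negz_add1.
apply: execb_le (execb_while _ (execb_seq X1 (execb_seq Xm (test_exec _ _ _))) X2).
  by move: (cost _) => a; nia.
rewrite phys_reg // E subr_ge0 /=; case: ifP => _; first lra.
by case: eqP => _; [rewrite ltnn /=; lra|case: (_ < _)%N => /=; lra].
Qed.

Definition open_cost := (cost (mvR : cmd R) + cost (mvR : cmd R) + 200)%N.

(** The last clause bounds what the walk leaves on the negative cells. Some of these cells become
    time stamps, so epochs have to exceed 2. *)
Lemma open_gap_exec x : exists rho h,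
  [/\ execb open_gap (input x) (open_cost * (size x + 1)) (phys 0 rho h),
      rho rN = (size x)%:R, (forall k : nat, h k = x`_k) &
      (forall j, h (Negz j) <= 2)].
Proof.
pose s1 := den begin_prog (input x).
have X1 : execb begin_prog (input x) 4 s1 by exact: den_exec.
case: (posnP (size x)) => n0.
  have x0 : x = [::] by exact: size0nil.
  (* Without marks the tape is blank, and blank cells left of the origin already form a gap with
     zero registers. *)
  have s10 : s1 = phys 0 (fun _ => 0) (fun _ => 0).
    apply/funext => i; rewrite /s1 /= /upd /= n0 /phys.
    case: i => [k|j]; first by rewrite /= x0 nth_nil.
    by rewrite /= n0 !addr0 subr0 !if_same.
  exists (fun _ => 0), (fun _ => 0); split; rewrite ?n0 //.
  - rewrite add0n muln1; apply: execb_le (execb_seq X1 (execb_if _)); last first.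
      by rewrite s10 phys_reg // lexx; apply: (exec_den (T := 1)).
    by [].
  - by move=> k; rewrite x0 nth_nil.
have X2 : execb mark_prog s1 20 (fun i => walk_tape x 1 (i + Negz 1)).
  apply: exec_den => //; rewrite /mark_prog 2!den_seq.
  have -> : den (CConst (Negz 0) (1 / 2)) (den (CArith Add (Negz 1) (Negz 1) (Negz 0)) s1)
      = upd (input x) (Negz 0) (1 / 2).
    apply/funext => i; rewrite /s1 /= /upd /=.
    case: eqP => // _; case: eqP => [->|//]; rewrite /=.
    by case: (_ < _)%N; case: (_ < _)%N => /=; lra.
  apply/funext => i; rewrite /= /upd /=.
  have -> : i - 1 - 1 = i + Negz 1 by rewrite -addrA.
  case: eqP => [->|i1] //; case: eqP => [->|i0] /=.
    by [].
  case: eqP => [|_]; first by move: i1; rewrite NegzE; lia.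
  case E: (i + Negz 1) => [a|j] //=.
  have j0 : j <> 0%N by move=> j0; move: E i1; rewrite j0; rewrite !NegzE; lia.
  have j1 : j <> 1%N by move=> j1; move: E i0; rewrite j1; rewrite !NegzE; lia.
  by case: j E j0 j1 => [|[|j]].
have X3 := @walk_exec x 1 ltac:(lia).
pose H := walk_tape x (size x).
(* Everything left of the first blank is zero, so the head may be regarded as standing next to a gap
   with zero registers. *)
have S3 : (fun i => walk_tape x (size x) (i + Negz (size x))) =
   phys (Negz (size x)) (fun _ => 0) H.
  have H0 j : walk_tape x (size x) (Negz j + Negz (size x)) = 0.
    have -> : Negz j + Negz (size x) = Negz (j + size x).+1 by rewrite !NegzE; lia.
    rewrite /walk_tape; case: eqP => // _.
    have -> : ((j + size x).+1 < size x)%N = false by lia.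
    by case: eqP => // E; lia.
  apply/funext => -[a|j]; rewrite /phys; first by rewrite addrC.
  by rewrite H0 [X in H X]addrC /H H0 !if_same.
rewrite S3 in X3.
have X4 := test_exec (Negz (size x)) (fun _ => 0) H.
have [rho5 [X5 E5]] := @count_exec x (size x) _ (leqnn _)
   (erefl : upr (fun _ => 0) t0 (1 - H (Negz (size x))) t0 = _).
exists rho5, H; split.
- have X6 : execb mvR (phys (Negz 0) rho5 H) (cost (mvR : cmd R)) (phys 0 rho5 H).
    by apply: exec_den => //; rewrite den_mvR.
  apply: execb_le (execb_seq X1 (execb_if _)); last first.
    have -> : (0 <= s1 (Negz 1)) = false.
      apply/negbTE; rewrite -ltNge /s1 /= /upd /= n0.
      by case: (_ < _)%N => /=; lra.
    exact: (execb_seq X2 (execb_seq X3 (execb_seq X4 (execb_seq X5 X6)))).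
  by rewrite /open_cost; move: (cost _) => a; nia.
- by rewrite E5 /upr /= add0r.
- by [].
- move=> j; rewrite /H /walk_tape; case: eqP => // _; case: ifP => _; first lra.
  by case: eqP => _; case: (_ < _)%N => /=; lra.
Qed.

End Preparation.

(** * From semi-decision to decision *)

Section PolynomialBounds.
Variable R : realType.

(** The factor [c] is a natural number above the sum of the absolute values of the coefficients, and
    every power of [r] is at most [(r + 1) ^+ size p]. A clock needs a natural number of rounds,
    whereas [p] has real coefficients. *)
Lemma poly_bound (p : {poly R}) :
  exists c d : nat, forall r : R, 0 <= r -> p.[r] <= c%:R * (r + 1) ^+ d.
Proof.
pose a := \sum_(i < size p) `|p`_i|.
have a0 : 0 <= a by apply: sumr_ge0.
exists (Num.bound a), (size p) => r r0; rewrite horner_coef.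
apply: (@le_trans _ _ (a * (r + 1) ^+ size p)); last first.
  rewrite ler_wpM2r ?exprn_ge0 ?addr_ge0 //.
  by apply: ltW; apply: archi_boundP.
rewrite /a mulr_suml; apply: ler_sum => i _.
apply: (@le_trans _ _ (`|p`_i| * r ^+ i)).
  by rewrite ler_wpM2r ?exprn_ge0 ?ler_norm.
rewrite ler_wpM2l // (@le_trans _ _ ((r + 1) ^+ i)) //.
  by rewrite lerXn2r ?nnegrE ?addr_ge0 // lerDl.
by rewrite ler_weXn2l ?lerDr // ltnW.
Qed.

(** The successor in the coefficient turns a weak bound into the strict one asked of running
    times. *)
Definition growth (c d : nat) : {poly R} := (c.+1)%:R%:P * ('X + 1%:P) ^+ d.

Lemma lt_growth c d (r : R) (t : nat) : 0 <= r -> t%:R <= c%:R * (r + 1) ^+ d ->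
  t%:R < (growth c d).[r].
Proof.
move=> r0 tr; rewrite /growth !hornerE.
apply: (le_lt_trans tr); rewrite ltr_pM2r ?ltr_nat //.
by rewrite exprn_gt0 // ltr_wpDl.
Qed.

Lemma natr_pow c n d : c%:R * (n%:R + 1) ^+ d = (c * (n + 1) ^ d)%N%:R :> R.
Proof. by rewrite natrM natrX natrD. Qed.

End PolynomialBounds.

Section UnaryTrack.
Variable R : realType.
Implicit Types (s h : tape R) (rho : nat -> R) (P : int) (x z : seq R).

(** The unary marks of the simulated input are not stored but computed from its length [rm].
    Changing the register is then enough to present a longer padded word. *)
Definition ini1 h0 (rm : R) (i : int) : R :=
  if 0 <= i then h0 (16 * i) else if 0 <= i%:~R + rm then 1 else 0.

Definition initc1 (o : int) : cmd R :=
  CSeq (opc Add t0 rP o%:~R) (ifr t0 (load t0 (16 * o))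
    (CSeq (op Add t0 t0 rM) (ifr t0 (setc t0 1) (setc t0 0)))).

Lemma initc1_den rn rm rl e h0 o P rho h : at_block rn rm rl e h0 P rho h ->
  exists rho', den (initc1 o) (phys (16 * P) rho h) = phys (16 * P) rho' h /\
    rho' t0 = ini1 h0 rm (P + o) /\ keep [:: t0; t1] rho rho'.
Proof.
move=> [[_ Em _ F] _ EP _]; rewrite /initc1 den_seq den_opc // den_ifr //.
have -> : upr rho t0 (rho rP + o%:~R) t0 = (P + o)%:~R.
  by rewrite /upr eqxx EP intrD.
rewrite ler0z /ini1; case: ifP => Po.
  rewrite den_load //; eexists; split; first reflexivity.
  split; last by do 2!apply: keep_upr => //.
  rewrite /upr eqxx; have -> : 16 * P + 16 * o = 16 * (P + o) by ring.
  by have [] := F (P + o).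
rewrite den_seq den_op // den_ifr //.
have -> : arith_rho Add t0 t0 rM (upr rho t0 (rho rP + o%:~R)) t0 = (P + o)%:~R + rm.
  by rewrite /arith_rho /upr /= EP Em intrD.
case: ifP => _; rewrite den_setc //; eexists; (split; first reflexivity);
  (split; first by rewrite /upr eqxx); by do 3!apply: keep_upr => //.
Qed.

(** Every stamp is at most [e'], hence older than the new epoch [e], so all cells are read from the
    initial data: the simulated tape is [input z] whatever earlier runs have left. *)
Lemma simulate1_exec (N : machine R) z T e e' rho h :
  rho rM = (size z)%:R -> rho rE = e -> rho rC = T%:R - 1 ->
  (forall k : nat, h (16 * k%:Z) = z`_k) -> stamps e' h -> e' < e ->
  exists rho' h',
  [/\ execb (simulate N initc1) (phys 0 rho h) (sim_cost N initc1 * (T + 1))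
        (phys 0 rho' h'),
      rho' rV = if halted N (input z) T then (run N (input z) T).2 0 else 0,
      (forall k : nat, h' (16 * k%:Z) = z`_k) /\
        (forall i : int, h' (16 * i + 1) = h (16 * i + 1)),
      stamps e h' & keep (rC :: volatile) rho rho'].
Proof.
move=> Em Ee EC hz st ee.
have G : good (rho rN) (rho rM) (rho rL) h rho h by split.
have free o : loopfree (initc1 o) by [].
have [rho' [h' [X [_ _ _ F] S K V]]] :=
  simulate_exec N free (@initc1_den _ _ _ _ _) G Ee EC.
exists rho', h'; split=> //.
- rewrite V; suff -> : rep e (ini1 h (rho rM)) h = input z by [].
  apply/funext => i; rewrite /rep leNgt (le_lt_trans (st i) ee) /= /ini1.
  case: i => [k|j] /=; first exact: hz.
  rewrite Em NegzE; have -> : (- (j.+1%:Z))%:~R + (size z)%:R =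
     ((size z)%:Z - j.+1%:Z)%:~R :> R by rewrite intrD addrC.
  rewrite ler0z; have -> : (0 <= (size z)%:Z - j.+1%:Z) = (j < size z)%N by lia.
  by case: ifP.
- by split=> [k|i]; [have [-> _] := F k|have [_ ->] := F i].
- by apply: S => i; apply: le_trans (st i) _; exact: ltW.
Qed.

Lemma sum_costs_le (oc sc ck sm c n d : nat) :
  (oc * (n + 1) + (sc * (n + 1) ^ 2 + (5 + (ck + (sm * (c * (n + 1) ^ d + 1) + 3)))) <=
  (oc + sc + ck + sm * (c + 1) + 8) * (n + 1) ^ (d + 2))%N.
Proof.
have pos k : (0 < (n + 1) ^ k)%N by rewrite expn_gt0 addn1.
have mono k : (k <= d + 2)%N -> ((n + 1) ^ k <= (n + 1) ^ (d + 2))%N.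
  by move=> kd; rewrite leq_pexp2l // addn1.
have := mono 1%N ltac:(lia); have := mono 2%N ltac:(lia); have := mono d ltac:(lia).
have := pos (d + 2)%N; rewrite expn1.
move: ((n + 1) ^ (d + 2))%N ((n + 1) ^ 2)%N ((n + 1) ^ d)%N => Z A B Z0 BZ AZ nZ.
have H1 : (oc * (n + 1) <= oc * Z)%N by rewrite leq_mul2l nZ orbT.
have H2 : (sc * A <= sc * Z)%N by rewrite leq_mul2l AZ orbT.
have H3 : (c * B + 1 <= (c + 1) * Z)%N.
  by have : (c * B <= c * Z)%N; [rewrite leq_mul2l BZ orbT|nia].
have H4 : (sm * (c * B + 1) <= sm * ((c + 1) * Z))%N by rewrite leq_mul2l H3 orbT.
nia.
Qed.

(* A semi-decision procedure with a polynomial time bound on the accepted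
   inputs becomes a decision procedure once it is run against a clock. *)
Lemma clocked_P (M : machine R) (p : {poly R}) (X : set (seq R)) :
  (forall x, X x -> (time M (input x) < (p.[(size x)%:R])%:E)%E) ->
  (forall x, (time M (input x) < +oo)%E -> (0 < output M (input x) <-> X x)) ->
  P_R X.
Proof.
move=> Mt Mc; have [c [d cd]] := poly_bound p.
pose prog := CSeq (open_gap R) (CSeq (spread R 16)
  (CSeq (CSeq (opc Add rM rN 0) (setc rE 3))
    (CSeq (set_clock R rN c d) (CSeq (simulate M initc1) (store 0 rV))))).
pose K := (open_cost R + spread_cost R 16 + cost (set_clock R rN c d) +
   sim_cost M initc1 * (c + 1) + 8)%N.
exists (mach prog), (growth R K (d + 2)) => x.
pose T := (c * (size x + 1) ^ d)%N.
suff [s' [X1 Es]] : exists s', execb prog (input x) (K * (size x + 1) ^ (d + 2)) s' /\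
    s' 0 = if halted M (input x) T then (run M (input x) T).2 0 else 0.
  have [t tK Xt] := X1; split.
    apply: (le_lt_trans (halted_time (exec_halted Xt))); rewrite lte_fin.
    by apply: lt_growth => //; rewrite natr_pow ler_nat.
  rewrite (exec_output Xt) Es; split=> [|Xx].
    case: ifP => [h|_]; last by rewrite ltxx.
    rewrite -(halted_output h) => /Mc; apply.
    by apply/time_fin; exists T.
  have [u hu] := time_lt_halted (Mt x Xx).
  rewrite lte_fin => /lt_le_trans/(_ (cd _ (ler0n _ _))).
  rewrite natr_pow ltr_nat => uT.
  have hT := halted_leq hu (ltnW uT : (u <= T)%N).
  rewrite hT -(halted_output hT); apply/Mc => //.
  by apply/time_fin; exists T.
have [rho1 [h1 [X1 E1 hx hl]]] := open_gap_exec x.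
have [rho2 [X2 k2]] := spread_exec (isT : (1 < 16)%N) E1 hx.
pose h2 := spread_tape 16 x h1 0.
pose rho3 := upr (upr rho2 rM (size x)%:R) rE 3.
have X3 : execb (CSeq (opc Add rM rN 0) (setc rE 3)) (phys 0 rho2 h2) 5 (phys 0 rho3 h2).
  apply: exec_den => //; rewrite den_seq den_opc // den_setc //.
  by rewrite k2 // E1 addr0.
have [rho4 [X4 E4 k4]] := set_clock_exec c d 0 rho3 h2 (isT : (rN < 15)%N) isT.
have E4' : rho4 rC = T%:R - 1.
  by rewrite E4 /rho3 /upr /= k2 // E1 natr_pow.
have [|||||rho5 [h5 [X5 E5 _ _ _]]] := @simulate1_exec M x T 3 2 rho4 h2 _ _ E4' _ _ _.
- by rewrite k4.
- by rewrite k4.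
- move=> k; rewrite /h2 /spread_tape -PoszM; case: ltnP => // _.
  by rewrite dvdn_mulr // mulKn.
(* Column 4 contains no multiple of 16, so it is blank among the spread data; left of the origin the
   leftovers are at most 2, below the epoch 3. *)
- move=> i; rewrite /h2 /spread_tape; case E: (16 * i + 4) => [b|j]; last exact: hl.
  case: ltnP => // _; case: ifP => [/andP[/dvdnP[k Ek] _]|_]; last by lra.
  by move: E; rewrite Ek; lia.
- by rewrite ltr_nat.
exists (phys 0 rho5 (upd h5 0 (rho5 rV))); split; last first.
  by rewrite /phys /= /upd eqxx E5.
have X6 : execb (store 0 rV) (phys 0 rho5 h5) 3 (phys 0 rho5 (upd h5 0 (rho5 rV))).
  by apply: exec_den => //; rewrite den_store.
apply: execb_le (sum_costs_le _ _ _ _ _ _ _) _.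
exact: execb_seq X1 (execb_seq X2 (execb_seq X3 (execb_seq X4 (execb_seq X5 X6)))).
Qed.

Lemma Size1 (X : set (seq R)) H x : 
  Size (@Problem R X (fun _ => 1%E) H) x = ((size x)%:R)%:E.
Proof. by rewrite /Size /= ln1 mul0r addr0 mulr1. Qed.

Lemma NP_sub_P (X : set (seq R)) :
  (forall A : problem R, NP'_R A -> P'_R A) -> NP_R X -> P_R X.
Proof.
move=> sub [M [p [Mc Ms]]].
have c1 (x : seq R) : (1 <= (fun _ => 1%E) x :> \bar R)%E by [].
have /sub[N [q [Nt Nc]]] : NP'_R (@Problem R X (fun _ => 1%E) c1).
  exists M, p; split=> // x Xx _; rewrite Size1 /=; exact: Mc.
apply: (@clocked_P N q X) => // x Xx; have := Nt x Xx; rewrite Size1 /=.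
by apply; rewrite ltry.
Qed.

End UnaryTrack.

(** * Searching for a time bound *)

Section Search.
Variable R : realType.
Implicit Types (s h : tape R) (rho : nat -> R) (P : int) (x z : seq R).

(* [x] padded to length [8 * T]: [x_p] is at position [16 * p], and position 1
   holds the length of [x]. *)
Definition padded_at x (k : nat) : R :=
  if k == 1%N then (size x)%:R else if (16 %| k)%N then x`_(k %/ 16) else 0.
(** The 8 entries per unit of time let the verifier recover [T] by counting blocks of 16 cells on
    the pair tape. *)
Definition padded x (T : nat) : seq R := mkseq (padded_at x) (8 * T).

(** The hypothesis says that all positions [16 * p] with [p < size x], and position 1, lie below
    [8 * T], so that nothing of [x] is cut off. *)
Lemma nth_padded x T k : (2 * size x < T)%N -> (padded x T)`_k = padded_at x k.
Proof.
move=> nT; case: (ltnP k (8 * T)) => kT; first by rewrite nth_mkseq.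
rewrite nth_default ?size_mkseq // /padded_at; case: eqP => [|_]; first lia.
case: ifP => // /dvdnP[j Ej]; have nj : (size x <= j)%N by lia.
by rewrite Ej mulnK // nth_default.
Qed.

Variables (N : machine R) (c d : nat) (Y : set (seq R)).
Hypothesis N_decides : forall z,
  halted N (input z) (c * (size z + 1) ^ d) /\
  (0 < (run N (input z) (c * (size z + 1) ^ d)).2 0 <-> Y z).

(** The padding costs nothing: its zeros are on the tape already, and only the length [rM] grows
    from round to round. The guard [rI] is the opposite of the verdict, so the loop goes on exactly
    while [N] rejects. *)
Definition search_body : cmd R :=
  CSeq (CSeq (opc Add rE rE 1) (opc Mul rM rT 8))
    (CSeq (set_clock R rM c d) (CSeq (simulate N (@initc1 R))
      (CSeq (opc Mul rI rV (-1)) (opc Add rT rT 1)))).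
(** Cell 16 is the data cell of position 1 of the padded word, which holds the length of [x]. The
    first bound is [2 * n + 1], the least one for which the padding holds all of [x], and [rI = 0]
    lets the loop start. *)
Definition search_init : cmd R :=
  CSeq (CSeq (store 16 rN) (setc rE 2))
    (CSeq (opc Mul rT rN 2) (CSeq (opc Add rT rT 1) (setc rI 0))).
Definition search_start : cmd R :=
  CSeq (open_gap R) (CSeq (spread R 256) search_init).
Definition search : cmd R :=
  CSeq search_start (CSeq (whiler rI search_body) (store 0 rV)).

(** The data clause does not mention [T]: [padded_at] is the same for all bounds, so one preparation
    of the tape serves all rounds. *)
Record searching x (T : nat) rho h : Prop := Searching {
  searching_rT : rho rT = T%:R;
  searching_stamps : stamps (rho rE) h;
  searching_data : forall k : nat, h (16 * k%:Z) = padded_at x k }.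

Definition round_cost (T : nat) :=
  (cost (set_clock R rM c d) + sim_cost N (@initc1 R) * (c * (8 * T + 1) ^ d + 1) + 20)%N.

Lemma search_body_exec x T rho h : (2 * size x < T)%N -> searching x T rho h ->
  exists rho' h', [/\ execb search_body (phys 0 rho h) (round_cost T) (phys 0 rho' h'),
    searching x T.+1 rho' h', 0 <= rho' rI <-> ~ Y (padded x T) &
    0 < rho' rV <-> Y (padded x T)].
Proof.
move=> nT [ET ES ED].
pose rho1 := upr (upr rho rE (rho rE + 1)) rM (8 * T)%N%:R.
have X1 : execb (CSeq (opc Add rE rE 1) (opc Mul rM rT 8)) (phys 0 rho h) 8
    (phys 0 rho1 h).
  apply: exec_den => //; rewrite den_seq !den_opc //.
  have -> // : upr rho rE (rho rE + 1) rT * 8 = (8 * T)%N%:R.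
  by rewrite /upr /= ET mulrC natrM.
have [rho2 [X2 E2 k2]] := set_clock_exec c d 0 rho1 h (isT : (rM < 15)%N) isT.
pose z := padded x T; have sz : size z = (8 * T)%N by rewrite size_mkseq.
have E2' : rho2 rC = (c * (size z + 1) ^ d)%N%:R - 1.
  by rewrite E2 /rho1 {1}/upr /= natr_pow sz.
have [||||rho3 [h3 [X3 E3 [D3 _] S3 k3]]] :=
    @simulate1_exec R N z (c * (size z + 1) ^ d) (rho rE + 1) (rho rE) rho2 h
      _ _ E2' _ ES _.
- by rewrite k2 // sz.
- by rewrite k2.
- by move=> k; rewrite nth_padded.
- by rewrite ltrDl.
have [hN YN] := N_decides z; rewrite hN in E3.
pose rho4 := upr (upr rho3 rI (- rho3 rV)) rT T.+1%:R.
have X4 : execb (CSeq (opc Mul rI rV (-1)) (opc Add rT rT 1)) (phys 0 rho3 h3) 8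
    (phys 0 rho4 h3).
  apply: exec_den => //; rewrite den_seq !den_opc // mulrN1.
  have -> // : upr rho3 rI (- rho3 rV) rT + 1 = T.+1%:R.
  by rewrite /upr /= k3 // k2 // /rho1 /upr /= ET natr1.
exists rho4, h3; split.
- apply: execb_le (execb_seq X1 (execb_seq X2 (execb_seq X3 X4))).
  by rewrite /round_cost sz; lia.
- split; first by rewrite /rho4 /upr.
  + by rewrite /rho4 /upr /= k3 // k2.
  + by move=> k; rewrite D3 nth_padded.
- rewrite /rho4 /upr /= E3 oppr_ge0 leNgt; split=> [/negP n /YN //|n].
  by apply/negP => /YN.
- by rewrite /rho4 /upr /= E3.
Qed.

Lemma search_start_exec x : exists rho h,
  [/\ execb search_start (input x)
        (open_cost R * (size x + 1) + (spread_cost R 256 * (size x + 1) ^ 2 + 20))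
        (phys 0 rho h), searching x (2 * size x).+1 rho h & rho rI = 0].
Proof.
have [rho1 [h1 [X1 E1 hx hl]]] := open_gap_exec x.
have [rho2 [X2 k2]] := spread_exec (isT : (1 < 256)%N) E1 hx.
pose h2 := spread_tape 256 x h1 0.
pose h3 := upd h2 16 (size x)%:R.
have E2 : rho2 rN = (size x)%:R by rewrite k2.
exists (upr (upr (upr (upr rho2 rE 2) rT ((size x)%:R * 2)) rT (2 * size x).+1%:R) rI 0), h3.
split.
- apply: execb_seq X1 (execb_seq X2 _).
  apply: exec_den => //; rewrite /search_init den_seq [X in den _ X]den_seq.
  rewrite den_store // den_setc // 2!den_seq !den_opc // den_setc // add0r E2.
  have -> : upr rho2 rE 2 rN * 2 = (size x)%:R * 2 by rewrite /upr /= E2.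
  have -> // : upr (upr rho2 rE 2) rT ((size x)%:R * 2) rT + 1 = (2 * size x).+1%:R.
  by rewrite /upr /= -[(2 * size x).+1%:R]natr1 mulnC natrM.
- split; first by [].
  + rewrite /= => i; rewrite {2}/upr /= {1}/upr /= /h3 /upd; case: eqP => [|_]; first lia.
    rewrite /upr /=.
    rewrite /h2 /spread_tape; case E: (16 * i + 4) => [b|j]; last exact: hl.
    case: ltnP => // _; case: ifP => [/andP[/dvdnP[k Ek] _]|_]; last by [].
    by move: E; rewrite Ek; lia.
  + move=> k; rewrite /h3 /upd /padded_at.
    have -> : (16 * k%:Z == 16) = (k == 1%N) by apply/eqP/eqP; lia.
    case: eqP => // _; rewrite /h2 /spread_tape -PoszM; case: ltnP => // _.
    have -> : (256 = 16 * 16)%N by [].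
    by rewrite dvdn_pmul2l // divnMl // andbT.
- by [].
Qed.

(** [T1] is the first accepted bound; the cost of a round increases with the bound, so each round is
    charged as the last one. *)
Lemma search_finds x T0 T1 : (2 * size x < T0)%N -> (T0 <= T1)%N -> Y (padded x T1) ->
  (forall T, (T0 <= T < T1)%N -> ~ Y (padded x T)) ->
  forall rho h, searching x T0 rho h -> 0 <= rho rI -> exists rho' h',
  execb (whiler rI search_body) (phys 0 rho h) ((T1 - T0).+1 * (round_cost T1 + 2))
    (phys 0 rho' h') /\ 0 < rho' rV.
Proof.
move En: (T1 - T0)%N => n; elim: n T0 En => [|n IH] T0 En nT TT Y1 Yn rho h S I0.
  have ET : T0 = T1 by lia.
  rewrite ET in S nT.
  have [rho' [h' [X' S' I' V']]] := search_body_exec nT S.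
  exists rho', h'; split; last exact/V'.
  apply: execb_le (execb_while _ X' (execb_while_end _ _)).
  - by lia.
  - by rewrite phys_reg.
  - by rewrite phys_reg //; apply/negP => /I'.
have [rho' [h' [X' S' I' V']]] := search_body_exec nT S.
have a1 : (T1 - T0.+1)%N = n by lia.
have a4 T : (T0.+1 <= T < T1)%N -> ~ Y (padded x T) by move=> hT; apply: Yn; lia.
have a5 : 0 <= rho' rI by apply/I'/Yn; lia.
have [rho2 [h2 [X2 V2]]] :=
  IH T0.+1 a1 ltac:(lia) ltac:(lia) Y1 a4 rho' h' S' a5.
exists rho2, h2; split=> //.
apply: execb_le (execb_while _ X' X2); last by rewrite phys_reg.
have : (round_cost T0 <= round_cost T1)%N.
  rewrite /round_cost leq_add2r leq_add2l leq_mul2l leq_add2r leq_mul2l.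
  apply/orP; right; apply/orP; right.
  by case: d => [|d']; rewrite ?expn0 // leq_exp2r //; lia.
nia.
Qed.

End Search.

(** * Running time of the search in terms of the size *)

Section SearchTime.
Variable R : realType.

Lemma search_sum_le (oc sc ck sm c d n u T0 T1 : nat) : (n <= u)%N -> (T1 <= u)%N ->
  (oc * (n + 1) + (sc * (n + 1) ^ 2 + 20) +
     ((T1 - T0).+1 * (ck + sm * (c * (8 * T1 + 1) ^ d + 1) + 20 + 2) + 3) <=
  (oc + sc + ck + sm * (c * 8 ^ d + 1) + 50) * (u + 1) ^ (d + 2))%N.
Proof.
move=> nu Tu.
have pos k : (0 < (u + 1) ^ k)%N by rewrite expn_gt0 addn1.
have mono k : (k <= d + 2)%N -> ((u + 1) ^ k <= (u + 1) ^ (d + 2))%N.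
  by move=> kd; rewrite leq_pexp2l // addn1.
have E0 : ((8 * T1 + 1) ^ d <= 8 ^ d * (u + 1) ^ d)%N.
  rewrite -expnMn; case: (d) => [|d']; first by rewrite !expn0.
  by rewrite leq_exp2r //; lia.
have E1 : (c * (8 * T1 + 1) ^ d + 1 <= (c * 8 ^ d + 1) * (u + 1) ^ d)%N.
  have : (c * (8 * T1 + 1) ^ d <= c * (8 ^ d * (u + 1) ^ d))%N by rewrite leq_mul2l E0 orbT.
  by have := pos d; nia.
set F := (c * (8 * T1 + 1) ^ d + 1)%N in E1 *.
set G := (c * 8 ^ d + 1)%N in E1 *.
have E2 : (sm * F <= sm * (G * (u + 1) ^ d))%N by rewrite leq_mul2l E1 orbT.
have E3 : (ck + sm * F + 20 + 2 <= (ck + sm * G + 22) * (u + 1) ^ d)%N.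
  by have := pos d; nia.
have E4 : ((T1 - T0).+1 * (ck + sm * F + 20 + 2) <=
    (u + 1) * ((ck + sm * G + 22) * (u + 1) ^ d))%N.
  by apply: leq_mul => //; lia.
have E5 : ((u + 1) * ((ck + sm * G + 22) * (u + 1) ^ d) <=
   (ck + sm * G + 22) * (u + 1) ^ (d + 2))%N.
  rewrite mulnCA leq_mul2l -expnS; apply/orP; right; apply: mono; lia.
have E6 : (oc * (n + 1) <= oc * (u + 1) ^ (d + 2))%N.
  rewrite leq_mul2l; apply/orP; right.
  by apply: leq_trans (mono 1%N ltac:(lia)); rewrite expn1; lia.
have E7 : (sc * (n + 1) ^ 2 <= sc * (u + 1) ^ (d + 2))%N.
  rewrite leq_mul2l; apply/orP; right.
  by apply: leq_trans (mono 2%N ltac:(lia)); rewrite leq_exp2r //; lia.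
have E8 := leq_trans E4 E5; move: E6 E7 E8 (pos (d + 2)%N).
move: (_ * (_ + 20 + 2))%N (_ ^ (d + 2))%N (oc * (n + 1))%N (sc * _ ^ 2)%N
  => a Z b e Ha Hb Hd Z0.
by rewrite !mulnDl in Hd *; lia.
Qed.

Lemma size_le_Size (A : problem R) x : (Size A x < +oo)%E ->
  (size x)%:R <= fine (Size A x).
Proof.
rewrite /Size; have := cond_ge1 A x; case: (cond A x) => //= r.
rewrite lee_fin => r1 _; rewrite -[leLHS]mulr1 ler_wpM2l // lerDl.
by rewrite divr_ge0 ?ln_ge0 // ler1n.
Qed.

(** The time depends on the first accepted bound, which is at most any bound provided by
    completeness. It may be smaller than all of those, which is why soundness is asked at every
    bound. *)
Lemma search_P' (A : problem R) (Y : set (seq R)) (q : {poly R}) : P_R Y ->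
  (forall x T, (2 * size x < T)%N -> Y (padded x T) -> yes A x) ->
  (forall x, yes A x -> (Size A x < +oo)%E -> exists t : nat,
     t%:R < q.[fine (Size A x)] /\
     forall T, (t <= T)%N -> (2 * size x < T)%N -> Y (padded x T)) ->
  P'_R A.
Proof.
move=> [N [p0 Np]] sound complete.
have [c [d cd]] := poly_bound p0.
have N_decides z : halted N (input z) (c * (size z + 1) ^ d) /\
    (0 < (run N (input z) (c * (size z + 1) ^ d)).2 0 <-> Y z).
  have [tz oz] := Np z; have [t ht] := time_lt_halted tz.
  rewrite lte_fin => /lt_le_trans/(_ (cd _ (ler0n _ _))).
  rewrite natr_pow ltr_nat => tc.
  have hT := halted_leq ht (ltnW tc); split=> //.
  by rewrite -(halted_output hT).
(* This polynomial dominates the bound [u = t + (2 * size x).+1] used below, since [size x] is at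
   most the size. *)
have [c' [d' cd']] := poly_bound (q + 2%:R%:P * 'X + 1%:P).
pose K := (open_cost R + spread_cost R 256 + cost (set_clock R rM c d) +
  sim_cost N (@initc1 R) * (c * 8 ^ d + 1) + 50)%N.
have finds x : (exists2 T, (2 * size x < T)%N & Y (padded x T)) ->
  yes A x /\ exists t s', [/\ exec (search N c d) (input x) t s', 0 < s' 0 &
    forall u T, (T <= u)%N -> (2 * size x < T)%N -> Y (padded x T) ->
     (t <= K * (u + 1) ^ (d + 2))%N].
  move=> [T nT YT]; split; first exact: sound YT.
  have ex : exists T, (2 * size x < T)%N && `[< Y (padded x T) >].
    by exists T; rewrite nT; apply/asboolP.
  case: (ex_minnP ex) => T1 /andP[nT1 /asboolP Y1] T1min.
  have [rho1 [h1 [X1 S1 I1]]] := search_start_exec x.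
  have Yn T' : ((2 * size x).+1 <= T' < T1)%N -> ~ Y (padded x T').
    move=> /andP[T'0 T'1] Y'; have : (T1 <= T')%N by apply: T1min; rewrite T'0; apply/asboolP.
    by rewrite leqNgt T'1.
  have I0 : 0 <= rho1 rI by rewrite I1.
  have [rho2 [h2 [X2 V2]]] := search_finds N_decides (leqnn _) nT1 Y1 Yn S1 I0.
  have X3 : execb (store 0 rV) (phys 0 rho2 h2) 3 (phys 0 rho2 (upd h2 0 (rho2 rV))).
    by apply: exec_den => //; rewrite den_store.
  have [t tb Xt] := execb_seq X1 (execb_seq X2 X3).
  exists t, (phys 0 rho2 (upd h2 0 (rho2 rV))); split=> //.
  move=> u T2 T2u nT2 Y2; apply: leq_trans tb _.
  have T1u : (T1 <= u)%N.
    by apply: leq_trans T2u; apply: T1min; rewrite nT2; apply/asboolP.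
  by apply: search_sum_le => //; lia.
(* The time [K * (u + 1) ^ (d + 2)] is combined with [u + 1 <= (c' + 1) * (S + 1) ^ d'], where [S]
   is the size. *)
exists (mach (search N c d)), (growth R (K * (c' + 1) ^ (d + 2)) (d' * (d + 2))).
split=> [x Xx Sx|x /time_fin[t0' ht]].
  have [t [tq Yt]] := complete x Xx Sx.
  have nS := size_le_Size Sx; set S := fine _ in tq nS *.
  have S0 : 0 <= S by apply: le_trans nS.
  pose u := (t + (2 * size x).+1)%N.
  have Yu : Y (padded x u) by apply: Yt; rewrite /u; lia.
  have nu : (2 * size x < u)%N by rewrite /u; lia.
  have [_ [t' [s' [Xt s0 tb]]]] := finds x (ex_intro2 _ _ u nu Yu).
  have uS : u%:R <= c'%:R * (S + 1) ^+ d'.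
    apply: le_trans (cd' S S0); rewrite !hornerE /u natrD -natr1 natrM.
    by move: (ltW tq); lra.
  apply: (le_lt_trans (halted_time (exec_halted Xt))); rewrite lte_fin.
  apply: lt_growth => //.
  apply: (@le_trans _ _ (K%:R * (u%:R + 1) ^+ (d + 2))).
    by rewrite natr_pow ler_nat; apply: tb Yu.
  rewrite natrM -mulrA ler_wpM2l // natrX exprM -exprMn.
  have e1 : 1 <= (S + 1) ^+ d' by rewrite exprn_ege1 // lerDr.
  rewrite lerXn2r ?nnegrE ?addr_ge0 ?mulr_ge0 ?exprn_ge0 ?addr_ge0 //.
  by rewrite natrD mulrDl mul1r lerD.
have [ex|nex] := pselect (exists2 T, (2 * size x < T)%N & Y (padded x T)).
  by have [Ax [t [s' [Xt s0 _]]]] := finds x ex; rewrite (exec_output Xt).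
(* If no bound is accepted the loop never ends, so halting is contradictory. This also covers
   members of the problem of infinite size that have no accepted bound. *)
exfalso; have [rho1 [h1 [[t1' _ X1] S1 I1]]] := search_start_exec x.
pose Inv (s : tape R) := exists T rho h, [/\ s = phys 0 rho h, (2 * size x < T)%N,
   searching x T rho h & 0 <= rho rI].
have I : Inv (phys 0 rho1 h1).
  by exists (2 * size x).+1, rho1, h1; split=> //; rewrite I1.
have loops s : Inv s -> 0 <= s (Negz rI) /\
    exists t s', exec (search_body N c d) s t s' /\ Inv s'.
  move=> [T [rho [h [-> nT ST IT]]]]; split; first by rewrite phys_reg.
  have [rho' [h' [[t _ X'] S' I' _]]] := search_body_exec N_decides nT ST.
  exists t, (phys 0 rho' h'); split=> //; exists T.+1, rho', h'; split=> //; first lia.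
  by apply/I' => YT; apply: nex; exists T.
by move/negP: (while_diverges (store 0 rV) X1 I loops t0'); apply.
Qed.

End SearchTime.

(** * Guessing and verifying *)

Section Verifier.
Variable R : realType.
Implicit Types (s h : tape R) (rho : nat -> R) (P : int) (x y z w : seq R).

(** Initial content of cell [i] of a pair tape. A cell [i = 2 * p + 1] is compared through [i - 1]
    with twice [rl], which avoids halving [i]. Guessed entries beyond the guessed length are read as
    0, as are the cells after the end of an input. *)
Definition ini2 h0 (rn rl : R) (i : int) : R :=
  if (i %% 2)%Z == 0 then
    if 0 <= i then h0 (16 * i) else if 0 <= i%:~R + rn + rn then 1 else 0
  else if 0 <= i then if 0 <= i%:~R - 1 - rl - rl then 0 else h0 (16 * i + 1)
  else if 0 <= i%:~R * (-1) - 1 - rl - rl then 0 else 1.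

(** The parity of [o] is known when the program is written, so the sign of [- rPar] or of [rPar - 1]
    tells whether [P + o] is even. *)
Definition initc2 (o : int) : cmd R :=
  CSeq (if (o %% 2)%Z == 0 then opc Mul t1 rPar (-1) else opc Defs.Sub t1 rPar 1)
    (CSeq (opc Add t0 rP o%:~R)
    (ifr t1
      (ifr t0 (load t0 (16 * o))
        (CSeq (op Add t0 t0 rN) (CSeq (op Add t0 t0 rN)
          (ifr t0 (setc t0 1) (setc t0 0)))))
      (ifr t0
        (CSeq (opc Defs.Sub t0 t0 1) (CSeq (op Defs.Sub t0 t0 rL)
          (CSeq (op Defs.Sub t0 t0 rL) (ifr t0 (setc t0 0) (load t0 (16 * o + 1))))))
        (CSeq (opc Mul t0 t0 (-1)) (CSeq (opc Defs.Sub t0 t0 1)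
          (CSeq (op Defs.Sub t0 t0 rL) (CSeq (op Defs.Sub t0 t0 rL)
            (ifr t0 (setc t0 0) (setc t0 1))))))))).

Lemma initc2_den rn rm rl e h0 o P rho h : at_block rn rm rl e h0 P rho h ->
  exists rho', den (initc2 o) (phys (16 * P) rho h) = phys (16 * P) rho' h /\
    rho' t0 = ini2 h0 rn rl (P + o) /\ keep [:: t0; t1] rho rho'.
Proof.
move=> [[En _ El F] _ EP Epar]; rewrite /initc2 den_seq.
have [v [-> v0]] : exists v, den (if (o %% 2)%Z == 0 then opc Mul t1 rPar (-1)
      else opc Defs.Sub t1 rPar 1) (phys (16 * P) rho h) =
    phys (16 * P) (upr rho t1 v) h /\ (0 <= v) = (((P + o) %% 2)%Z == 0).
  case: ifP => o0; rewrite den_opc //; eexists; (split; first reflexivity);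
    rewrite Epar.
    rewrite mulrN1 oppr_ge0 lerz0; apply/idP/idP; move: o0; lia.
  rewrite subr_ge0 ler1z; apply/idP/idP; move: o0; lia.
set rho1 := upr rho t1 v.
have k1 : keep [:: t0; t1] rho rho1 by apply: keep_upr.
rewrite den_seq den_opc // den_ifr //.
have -> : rho1 rP = P%:~R by [].
rewrite -intrD; set rho2 := upr rho1 t0 _.
have k2 : keep [:: t0; t1] rho rho2 by apply: keep_upr.
have -> : rho2 t1 = v by [].
have E2 : rho2 t0 = (P + o)%:~R by [].
have cell : h (16 * P + 16 * o) = h0 (16 * (P + o)) /\
    h (16 * P + (16 * o + 1)) = h0 (16 * (P + o) + 1).
  have [<- <-] := F (P + o).
  by split; congr h; ring.
have fin rho3 u : keep [:: t0; t1] rho rho3 -> ini2 h0 rn rl (P + o) = u ->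
  exists rho', phys (16 * P) (upr rho3 t0 u) h = phys (16 * P) rho' h /\
    rho' t0 = ini2 h0 rn rl (P + o) /\ keep [:: t0; t1] rho rho'.
  move=> k3 E; exists (upr rho3 t0 u); split=> //; split; first by rewrite E /upr eqxx.
  exact: keep_upr.
rewrite /ini2 in fin *; rewrite v0; case: ifP => _ in fin *.
  rewrite den_ifr // E2 ler0z; case: ifP => _ in fin *.
    by rewrite den_load //; apply: fin => //; case: cell.
  rewrite den_seq den_op // den_seq den_op // den_ifr // /arith_rho.
  set rho3 := upr (upr rho2 t0 _) t0 _.
  have -> : rho3 t0 = (P + o)%:~R + rn + rn by rewrite /rho3 /rho2 /rho1 /upr /= En.
  have k3 : keep [:: t0; t1] rho rho3 by do 2!apply: keep_upr => //.
  by case: ifP => _ in fin *; rewrite den_setc //; exact: fin.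
rewrite den_ifr // E2 ler0z; case: ifP => _ in fin *.
  rewrite den_seq den_opc // den_seq den_op // den_seq den_op // den_ifr // /arith_rho.
  set rho3 := upr (upr _ t0 _) t0 _.
  have -> : rho3 t0 = (P + o)%:~R - 1 - rl - rl by rewrite /rho3 /rho2 /rho1 /upr /= El.
  have k3 : keep [:: t0; t1] rho rho3 by do 3!apply: keep_upr => //.
  case: ifP => _ in fin *; first by rewrite den_setc //; exact: fin.
  by rewrite den_load //; apply: fin => //; case: cell.
rewrite den_seq den_opc // den_seq den_opc // den_seq den_op // den_seq den_op //.
rewrite den_ifr // /arith_rho.
set rho3 := upr (upr _ t0 _) t0 _.
have -> : rho3 t0 = (P + o)%:~R * (-1) - 1 - rl - rl by rewrite /rho3 /rho2 /rho1 /upr /= El.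
have k3 : keep [:: t0; t1] rho rho3 by do 4!apply: keep_upr => //.
by case: ifP => _ in fin *; rewrite den_setc //; exact: fin.
Qed.

Lemma loopfree_initc2 o : loopfree (initc2 o).
Proof. by rewrite /initc2; case: ifP. Qed.

(* The data tape left on [input2 z w] once its 16 cells left of the origin are
   used for the gap. *)
Definition gapped z w : tape R := fun i =>
  match i with
  | Posz _ => input2 z w i
  | Negz j => input2 z w (Negz (j + 16))
  end.

(** Groups of 8 marks of [z] that remain once the gap has replaced the first group. *)
Definition blocks z : nat := (size z %/ 8 - 1)%N.

Lemma gapped_even z w (k : nat) : gapped z w (2 * k%:Z) = z`_k.
Proof.
have -> : 2 * k%:Z = (2 * k)%N by [].
rewrite /gapped /input2; have -> : ((2 * k)%N %% 2)%Z = 0 by lia.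
by have -> : ((2 * k)%N %/ 2)%Z = k by lia.
Qed.

Lemma gapped_odd z w (k : nat) : gapped z w (2 * k%:Z + 1) = w`_k.
Proof.
have -> : 2 * k%:Z + 1 = (2 * k + 1)%N by lia.
rewrite /gapped /input2; have -> : ((2 * k + 1)%N %% 2)%Z = 1 by lia.
by have -> : ((2 * k + 1)%N %/ 2)%Z = k by lia.
Qed.

Lemma gapped_neg z w (k : nat) : gapped z w (- (2 * k.+1%:Z)) = (k + 8 < size z)%N%:R.
Proof.
have -> : - (2 * k.+1%:Z) = Negz (2 * k + 1) by rewrite NegzE; lia.
rewrite /gapped /input2; have -> : (Negz (2 * k + 1 + 16) %% 2)%Z = 0 by rewrite NegzE; lia.
rewrite eqxx; have -> : (Negz (2 * k + 1 + 16) %/ 2)%Z = Negz (k + 8) by rewrite !NegzE; lia.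
by [].
Qed.

Lemma gapped_block z w (p : nat) : (0 < p)%N ->
  gapped z w (16 * - p%:Z) = (p <= blocks z)%N%:R.
Proof.
case: p => // p _; have -> : 16 * - p.+1%:Z = - (2 * (8 * p + 7).+1%:Z) by lia.
by rewrite gapped_neg /blocks; congr ((nat_of_bool _)%:R); lia.
Qed.

Definition probe : cmd R := CSeq (load t0 0) (opc Defs.Sub t0 t0 (1 / 2)).
Definition count_body : cmd R :=
  CSeq (opc Add rC rC 1) (CSeq (mvLn 16) (CSeq (opc Defs.Sub rP rP 1) probe)).
(** No blank cells are within reach, so the gap overwrites the 16 cells left of the origin, and the
    registers start with marks in them. Cells 2 and 3 hold [z_1] and [w_1], the announced lengths of
    the two inputs. *)
Definition count_start : cmd R :=
  CSeq (CConst (Negz 15) 0) (CSeq (CSeq (load rN 2) (CSeq (load rL 3)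
    (CSeq (setc rE 2) (CSeq (setc rC 0) (setc rP (-1)))))) (CSeq (mvLn 16) probe)).
Definition verifier (M : machine R) : cmd R :=
  CSeq count_start (CSeq (whiler t0 count_body)
    (CSeq (home R) (CSeq (simulate M initc2) (store 0 rV)))).

Lemma count_body_exec z w n p rho : (0 < p)%N -> (p + n = (blocks z).+1)%N ->
  rho rP = - p%:R -> rho t0 = (p <= blocks z)%N%:R - 1 / 2 -> exists rho',
  [/\ execb (whiler t0 count_body) (phys (16 * - p%:Z) rho (gapped z w))
        (n * (cost count_body + 1) + 1)
        (phys (16 * - (blocks z).+1%:Z) rho' (gapped z w)),
      rho' rP = - (blocks z).+1%:R, rho' rC = rho rC + n%:R &
      keep [:: rC; rP; t0] rho rho'].
Proof.
elim: n p rho => [|n IH] p rho p0 pn EP E0.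
  have Ep : p = (blocks z).+1 by lia.
  exists rho; split=> //; last by rewrite addr0.
    rewrite -Ep mul0n; apply: execb_while_end.
    by rewrite phys_reg // E0 Ep ltnn /= -ltNge; lra.
  by rewrite EP Ep.
pose rho1 := upr (upr (upr rho rC (rho rC + 1)) rP (- p.+1%:R)) t0
  ((p.+1 <= blocks z)%N%:R - 1 / 2).
have [rho2 [X2 P2 C2 k2]] := IH p.+1 rho1 isT ltac:(lia) erefl erefl.
exists rho2; split=> //.
- apply: execb_le (execb_while (T1 := cost count_body) _ _ X2); first lia.
    have -> : phys (16 * - p%:Z) rho (gapped z w) (Negz t0) = 1 / 2.
      rewrite phys_reg // E0; have -> : (p <= blocks z)%N by lia.
      by rewrite /=; lra.
    by lra.
  apply: exec_den => //; rewrite /count_body den_seq den_opc // den_seq den_mvLn.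
  rewrite den_seq den_opc // /probe den_seq den_load // den_opc // addr0.
  have -> : 16 * - p%:Z - 16%:Z = 16 * - p.+1%:Z by lia.
  rewrite gapped_block //.
  have -> : upr rho rC (rho rC + 1) rP - 1 = - p.+1%:R.
    by rewrite /upr /= EP -natr1 opprD.
  rewrite [X in X - 1 / 2](_ : _ = (p.+1 <= blocks z)%N%:R); last by rewrite /upr eqxx.
  by congr phys; apply/funext => j; rewrite /rho1 /upr; case: eqP.
- by rewrite C2 /rho1 /upr /= -addrA [1 + _]addrC natr1.
- by apply: keep_trans k2; do 3!apply: keep_upr => //.
Qed.

(* What the simulated machine reads on its tape when the verifier is run on
   the pair [(z, w)]. *)
Definition decoded z w : tape R :=
  rep 2 (ini2 (gapped z w) z`_1 w`_1) (gapped z w).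

Definition verify_cost (M : machine R) :=
  (cost count_start + cost count_body + home_cost R + home_cost R +
   sim_cost M initc2 + sim_cost M initc2 + 10)%N.

(** Nothing is assumed on [z]: if it is not a padded word the decoded tape may be meaningless, but
    the clock still bounds the time, as membership of [guesses] in NP demands. *)
Lemma verifier_exec (M : machine R) z w : exists s',
  execb (verifier M) (input2 z w) (verify_cost M * (size z + 1)) s' /\
  s' 0 = if halted M (decoded z w) (blocks z).+1
         then (run M (decoded z w) (blocks z).+1).2 0 else 0.
Proof.
pose rho0 j := input2 z w (Negz j).
have start : den (CConst (Negz 15) 0) (input2 z w) = phys 0 rho0 (gapped z w).
  apply/funext => -[k|j].
    by rewrite -[LHS]/(input2 z w k) /phys add0r.
  rewrite -[LHS]/(if j == 15%N then 0 else input2 z w (Negz j)) /phys add0r.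
  case: (ltngtP j 15) => // jl.
  by rewrite /gapped subnK.
pose rho1 := upr (upr (upr (upr (upr (upr rho0 rN z`_1) rL w`_1) rE 2) rC 0) rP (-1))
  t0 ((1 <= blocks z)%N%:R - 1 / 2).
have X1 : execb count_start (input2 z w) (cost count_start)
    (phys (16 * - 1%:Z) rho1 (gapped z w)).
  have g2 : gapped z w (0 + 2) = z`_1 := gapped_even z w 1.
  have g3 : gapped z w (0 + 3) = w`_1 := gapped_odd z w 1.
  apply: exec_den => //; rewrite /count_start den_seq start den_seq.
  rewrite [X in den _ X]den_seq den_load // g2.
  rewrite [X in den _ X]den_seq den_load // g3.
  rewrite [X in den _ X]den_seq den_setc // [X in den _ X]den_seq !den_setc //.
  rewrite den_seq den_mvLn /probe den_seq den_load // den_opc // addr0.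
  have -> : 0 - 16%:Z = 16 * - 1%:Z by [].
  rewrite (gapped_block z w (isT : (0 < 1)%N)).
  rewrite [X in X - 1 / 2](_ : _ = (1 <= blocks z)%N%:R); last by rewrite /upr eqxx.
  by congr phys; apply/funext => j; rewrite /rho1 /upr; case: eqP.
have [rho2 [X2 P2 C2 k2]] := @count_body_exec z w (blocks z) 1 rho1 isT erefl erefl erefl.
have P2' : rho2 rP = (- (blocks z).+1%:Z)%:~R by rewrite P2 intrN.
have [rho3 [X3 k3]] := home_exec (gapped z w) P2'.
(* The count falls one short of the number of groups, the gap having replaced one; this is precisely
   the starting value of a clock for that many steps. *)
have C3 : rho3 rC = (blocks z).+1%:R - 1.
  by rewrite k3 // C2 /rho1 /upr /= add0r -natr1 addrK.
have G : good z`_1 (rho3 rM) w`_1 (gapped z w) rho3 (gapped z w).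
  by split=> //; rewrite k3 // k2.
have E3 : rho3 rE = 2 by rewrite k3 // k2.
have [rho4 [h4 [X4 _ _ _ V4]]] :=
  simulate_exec M loopfree_initc2 (@initc2_den _ _ _ _ _) G E3 C3.
exists (phys 0 rho4 (upd h4 0 (rho4 rV))); split; last first.
  by rewrite /phys /= /upd eqxx V4.
have X5 : execb (store 0 rV) (phys 0 rho4 h4) 3 (phys 0 rho4 (upd h4 0 (rho4 rV))).
  by apply: exec_den => //; rewrite den_store.
apply: execb_le (execb_seq X1 (execb_seq X2 (execb_seq X3 (execb_seq X4 X5)))).
have bz : (blocks z <= size z)%N.
  by rewrite /blocks; apply: leq_trans (leq_subr _ _) (leq_div _ _).
rewrite /verify_cost; move: (sim_cost _ _) (home_cost _) (cost _) (cost _) bz => a b c1 c2.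
have -> : `|- (blocks z).+1%:Z|%N = (blocks z).+1 by lia.
move: (blocks z) (size z) => k n kn.
have H1 : (a * (k.+1 + 1) <= a * (2 * (n + 1)))%N by rewrite leq_mul2l; lia.
have H2 : (b * (k.+1 + 1) <= b * (2 * (n + 1)))%N by rewrite leq_mul2l; lia.
have H3 : (k * (c2 + 1) <= (n + 1) * (c2 + 1))%N by rewrite leq_mul2r; lia.
have H4 : (k * (c1 + 1) <= (n + 1) * (c1 + 1))%N by rewrite leq_mul2r; lia.
nia.
Qed.

(** Column 4 of a block meets the padded word at positions [8 * k + 2], where it is zero, and the
    marks on the left are at most 1; so with epoch 2 no cell passes for already written. *)
Lemma decoded_padded x w T : (2 * size x < T)%N ->
  decoded (padded x T) w = ini2 (gapped (padded x T) w) (size x)%:R w`_1.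
Proof.
move=> nT; set z := padded x T.
have z1 : z`_1 = (size x)%:R by rewrite nth_padded.
rewrite /decoded z1; apply/funext => i; rewrite /rep.
suff -> : (2 <= gapped z w (16 * i + 4)) = false by [].
apply/negbTE; rewrite -ltNge; case: i => [k|j].
  have -> : 16 * Posz k + 4 = 2 * (8 * k + 2)%N%:Z by lia.
  rewrite gapped_even nth_padded // /padded_at.
  case: eqP => [|_]; first lia.
  by case: ifP => // /dvdnP[q]; lia.
have -> : 16 * Negz j + 4 = - (2 * (8 * j + 5).+1%:Z) by rewrite NegzE; lia.
by rewrite gapped_neg; case: (_ < _)%N => /=; lra.
Qed.

(** Virtual cell [2 * p + 1] takes its data from column 1 of its block, cell [16 * (2 * p + 1) + 1],
    where the odd track carries entry [8 * (2 * p + 1)] of [w]. *)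
Lemma ini2_input2 x y w T : (2 * size x < T)%N ->
  (forall p : nat, (w`_1 <= p%:R) = (size y <= p)%N) ->
  (forall p : nat, (p < size y)%N -> y`_p = w`_(8 * (2 * p + 1))) ->
  ini2 (gapped (padded x T) w) (size x)%:R w`_1 = input2 x y.
Proof.
move=> nT yw1 yw; apply/funext => i; rewrite /ini2 /input2.
have [p [Ep|Ep]] : exists p : int, i = 2 * p \/ i = 2 * p + 1.
- by exists (i %/ 2)%Z; lia.
- have -> : (i %% 2)%Z = 0 by lia.
  have -> : (i %/ 2)%Z = p by lia.
  rewrite eqxx; case: p Ep => [p|k] ->.
    have -> : 0 <= 2 * Posz p by lia.
    have -> : 16 * (2 * Posz p) = 2 * (16 * p)%N%:Z by lia.
    rewrite gapped_even nth_padded // /padded_at; case: eqP => [|_]; first lia.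
    by rewrite dvdn_mulr // mulKn.
  have -> : (0 <= 2 * Negz k) = false by rewrite NegzE; lia.
  rewrite /= -addrA -natrD -[(_ + _)%:R]/((size x + size x)%N%:Z%:~R) -intrD ler0z.
  have -> : (0 <= 2 * Negz k + (size x + size x)%N%:Z) = (k < size x)%N.
    by rewrite NegzE; lia.
  by case: ifP.
have -> : (i %% 2)%Z = 1 by lia.
have -> : (i %/ 2)%Z = p by lia.
have half (a : R) : (0 <= a + a) = (0 <= a).
  by apply/idP/idP => ?; lra.
rewrite [1 == 0]/=; case: p Ep => [p|k] ->.
  have -> : 0 <= 2 * Posz p + 1 by lia.
  have -> : (2 * Posz p + 1)%:~R - 1 - w`_1 - w`_1 = (p%:R - w`_1) + (p%:R - w`_1).
    by rewrite intrD intrM /= -[(Posz p)%:~R]/(p%:R); ring.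
  rewrite half subr_ge0 yw1 [input y _]/=; case: leqP => py.
    by rewrite nth_default.
  have -> : 16 * (2 * Posz p + 1) + 1 = 2 * (8 * (2 * p + 1))%N%:Z + 1 by lia.
  by rewrite gapped_odd yw.
have -> : (0 <= 2 * Negz k + 1) = false by rewrite NegzE; lia.
have -> : (2 * Negz k + 1)%:~R * (-1) - 1 - w`_1 - w`_1 = (k%:R - w`_1) + (k%:R - w`_1).
  by rewrite NegzE intrD intrM intrN -[(Posz k.+1)%:~R]/(k.+1%:R) -natr1; ring.
by rewrite half subr_ge0 yw1 /=; case: leqP.
Qed.

(** The guessed length is an arbitrary real but is compared with naturals only, so it acts as a
    natural number. *)
Lemma nat_threshold (r : R) : exists L : nat, forall p : nat, (r <= p%:R) = (L <= p)%N.
Proof.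
have ex : exists p : nat, r <= p%:R.
  exists (Num.bound `|r|); apply: le_trans (ler_norm r) _.
  by apply: ltW; apply: archi_boundP.
case: (ex_minnP ex) => L rL Lmin; exists L => p; apply/idP/idP; first exact: Lmin.
by move=> Lp; apply: le_trans rL _; rewrite ler_nat.
Qed.

Definition guesses (M : machine R) : set (seq R) :=
  [set z | exists w, 0 < output (mach (verifier M)) (input2 z w)].

Lemma guesses_NP (M : machine R) : NP_R (guesses M).
Proof.
exists (mach (verifier M)), (growth R (verify_cost M) 1); split=> [z [w zw]|z w _ zw].
  exists w; split=> //; have [s' [[t tb X] _]] := verifier_exec M z w.
  apply: (le_lt_trans (halted_time (exec_halted X))); rewrite lte_fin.
  by apply: lt_growth => //; rewrite natr_pow ler_nat expn1.
by exists w.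
Qed.

Lemma guesses_padded (M : machine R) x T : (2 * size x < T)%N ->
  guesses M (padded x T) <-> exists y, halted M (input2 x y) T /\
    0 < (run M (input2 x y) T).2 0.
Proof.
move=> nT.
have bT : (blocks (padded x T)).+1 = T.
  by rewrite /blocks size_mkseq mulKn //; lia.
have out w : output (mach (verifier M)) (input2 (padded x T) w) =
    if halted M (decoded (padded x T) w) T
    then (run M (decoded (padded x T) w) T).2 0 else 0.
  have [s' [[t _ X] E]] := verifier_exec M (padded x T) w.
  by rewrite (exec_output X) E bT.
split=> [[w]|[y [hy oy]]].
  rewrite out decoded_padded //; have [L HL] := nat_threshold w`_1.
  rewrite (@ini2_input2 x (mkseq (fun p => w`_(8 * (2 * p + 1))) L)) //.
  - by case: ifP => [h o|_]; [eexists; split; [exact: h|exact: o]|rewrite ltxx].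
  - by move=> p; rewrite size_mkseq.
  - by move=> p; rewrite size_mkseq => pL; rewrite nth_mkseq.
(* For [j = 8 * (2 * p + 1)] the double quotient is [p]. The summand 2 keeps position 1 inside [w]
   when [y] is empty. *)
pose w := mkseq (fun j => if j == 1%N then (size y)%:R else y`_(j %/ 8 %/ 2))
  (16 * size y + 2).
have w1 : w`_1 = (size y)%:R by rewrite nth_mkseq //; lia.
exists w; rewrite out decoded_padded // (@ini2_input2 x y) ?hy //.
- by move=> p; rewrite w1 ler_nat.
- move=> p py; rewrite nth_mkseq; last lia.
  case: eqP => [|_]; first lia.
  by congr nth; lia.
Qed.

Lemma NP'_sub_P' (A : problem R) :
  (forall X : set (seq R), NP_R X -> P_R X) -> NP'_R A -> P'_R A.
Proof.
move=> sub [M [q [Mt Ms]]].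
apply: (@search_P' R A (guesses M) q) (sub _ (guesses_NP M)) _ _ => [x T nT|x Ax Sx].
  move=> /(guesses_padded _ nT)[y [hy oy]]; apply: (Ms x y).
    by apply/time_fin; exists T.
  by rewrite (halted_output hy).
have [y [oy ty]] := Mt x Ax Sx; have [t ht tq] := time_lt_halted ty.
exists t; split; first by rewrite -lte_fin.
move=> T tT nT; apply/(guesses_padded _ nT); exists y.
have hT := halted_leq ht tT; split=> //.
by rewrite -(halted_output hT).
Qed.

End Verifier.

Theorem theorem5p9 (R : realType) :
  @P_R R <> @NP_R R <-> @P'_R R <> @NP'_R R.
Proof.
split=> neq eq; apply: neq.
  apply/seteqP; split=> X; first exact: P_sub_NP.
  by apply: NP_sub_P => A; rewrite eq.
apply/seteqP; split=> A; first exact: P'_sub_NP'.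
by apply: NP'_sub_P' => X; rewrite eq.
Qed.
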